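(* Let $a,b,c\in C(\mathbb{R}^+)$ and let $y\not\equiv 0$ be a solution of $$\dddot y(t)+a(t)\ddot y(t)+b(t)\dot y(t)+c(t)y(t)=0,\qquad t\in\mathbb{R}^+ .$$ Then for every $t>0$, $$\gamma_3(y,t)>\frac{\nu(y,t)-5}{2}\,L_{\Omega}.$$
   Context: For a solution $y$, $\nu(y,t)$ denotes the number of zeros of $y$ on $[0,t]$. Put $x(\tau)=(y(\tau),\dot y(\tau),\ddot y(\tau))\in\mathbb{R}^3$ (nonzero for all $\tau$ when $y\not\equiv0$) and $$\gamma_3(y,t)=\int_0^t\left|\frac{d}{d\tau}\left(\frac{x(\tau)}{|x(\tau)|}\right)\right|d\tau,$$ the length of the path traced by the unit vector $x(\tau)/|x(\tau)|$ on the unit sphere for $\tau\in[0,t]$ (Euclidean norm). Let $\Omega_+=\{(x_0,x_1,x_2)\in S^2:\ x_0x_2-x_1^2>0,\ x_2>0\}$ on the unit sphere $S^2\subset\mathbb{R}^3$. $L_\Omega$ is the length of the boundary of $\Omega_+$ on $S^2$; explicitly $L_{\Omega}=4\int_0^{\pi}\frac{\sqrt{5-\cos\alpha}}{7+\cos\alpha}\,d\alpha$. *)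

(* Defs.v *)
From Stdlib Require Import Reals List.
From Coquelicot Require Import Coquelicot.
Open Scope R_scope.

Definition cont_Rplus (f : R -> R) : Prop :=
  forall t, 0 <= t ->
    filterlim f (within (fun s => 0 <= s) (locally t)) (locally (f t)).

Definition deriv_Rplus (f df : R -> R) : Prop :=
  forall t, 0 <= t ->
    filterlim (fun h => (f (t + h) - f t) / h)
      (within (fun h => h <> 0 /\ 0 <= t + h) (locally 0)) (locally (df t)).

Definition is_solution (a b c y : R -> R) : Prop :=
  exists y1 y2 y3 : R -> R,
    deriv_Rplus y y1 /\ deriv_Rplus y1 y2 /\ deriv_Rplus y2 y3 /\
    forall t, 0 <= t -> y3 t + a t * y2 t + b t * y1 t + c t * y t = 0.

Definition nu_eq (y : R -> R) (t : R) (n : nat) : Prop :=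
  exists l : list R, NoDup l /\ length l = n /\
    forall s, In s l <-> (0 <= s <= t /\ y s = 0).

Definition xnorm (y : R -> R) (s : R) : R :=
  sqrt (y s ^ 2 + Derive y s ^ 2 + Derive (Derive y) s ^ 2).

Definition unit0 (y : R -> R) (s : R) : R := y s / xnorm y s.
Definition unit1 (y : R -> R) (s : R) : R := Derive y s / xnorm y s.
Definition unit2 (y : R -> R) (s : R) : R := Derive (Derive y) s / xnorm y s.

Definition gamma3 (y : R -> R) (t : R) : R :=
  RInt (fun s => sqrt (Derive (unit0 y) s ^ 2 + Derive (unit1 y) s ^ 2
                       + Derive (unit2 y) s ^ 2)) 0 t.

Definition L_Omega : R :=
  4 * RInt (fun al => sqrt (5 - cos al) / (7 + cos al)) 0 PI.

(* Main.v *)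
Require Import Defs.
From Stdlib Require Import Reals List.
From Stdlib Require Import Lra Lia Psatz Sorted Permutation IndefiniteDescription.
From Coquelicot Require Import Coquelicot.
Open Scope R_scope.

(** The proof is a discrete Crofton argument.  For [l < l'] the plane through
    [(1, l, l^2)] and [(1, l', l'^2)], two boundary rays of the cone over [Omega_+], is met by
    the path [x = (y, y', y'')] exactly when [(D - l) (D - l') y] vanishes.  A Rolle argument
    for this factored operator shows that along the path the difference of the spherical
    distances from [x / |x|] to the two boundary points swings between plus and minus the
    distance [d] of these points at least [nu - 3] times, so its total variation is at least
    [2 (nu - 3) d].  Summing over a fine polygon inscribed in the boundary of [Omega_+] gives
    nearly [2 (nu - 3) L_Omega].

    Conversely, when the path moves with velocity [w], the sum over the polygon of the
    absolute rates of change of these differences is the total variation of [|w| cos phi], where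
    [phi] is the direction in which the polygon's vertices are seen.  Since [cos] is an average
    of signs of linear forms and a linear form restricted to [(1, l, l^2)] is a quadratic,
    with at most two sign changes, that variation is at most [4 |w|].  Hence
    [4 gamma_3 >= 2 (nu - 3) (L_Omega - eta)], and [nu - 3 > nu - 5] absorbs [eta]. *)

(** * Finite sums, variation along lists, right derivatives *)

(** By the triangle inequality the difference of the distances to two boundary points [p], [q] stays
    in [[- d, d]]. It reaches an end of this range on the great circle of [p] and [q], between [q]
    and [- p] or between [p] and [- q]. At a zero of the factored operator the signs of [y' - l y]
    and [y' - l' y] tell which of these arcs carries the path, so the oscillation of [y] forces a
    bounded quantity from one extreme to the other, and no measure on the set of great circles is
    required.

    The count [nu - 3] arises as follows. Extremal positions are found around the zeros that have a
    gap on each side, which excludes the first and the last zero. A full swing needs two consecutive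
    such zeros, and [nu - 2] of them bound [nu - 3] gaps.

    A spherical distance has a corner where the path meets the vertex or its antipode, and a path
    may stop at or cross vertices in an arbitrary way. For this reason the upper bound works with
    right derivatives only, and the absolute values are replaced by fixed signs before anything is
    differentiated. *)

Fixpoint psum (m : nat) (f : nat -> R) : R :=
  match m with O => 0 | S k => psum k f + f k end.

Lemma psum_ext m f g : (forall j, (j < m)%nat -> f j = g j) -> psum m f = psum m g.
Proof.
  induction m as [|m IH]; simpl; intros H; [easy|].
  rewrite IH, H; auto with arith.
Qed.

Lemma psum_le m f g : (forall j, (j < m)%nat -> f j <= g j) -> psum m f <= psum m g.
Proof.
  induction m as [|m IH]; simpl; intros H; [lra|].
  apply Rplus_le_compat; auto with arith.
Qed.

Lemma psum_plus m f g : psum m (fun j => f j + g j) = psum m f + psum m g.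
Proof. induction m as [|m IH]; simpl; [|rewrite IH]; ring. Qed.

Lemma psum_scal m c f : psum m (fun j => c * f j) = c * psum m f.
Proof. induction m as [|m IH]; simpl; [|rewrite IH]; ring. Qed.

Lemma psum_const m c : psum m (fun _ => c) = INR m * c.
Proof. induction m as [|m IH]; [simpl; ring|]. rewrite S_INR; simpl; rewrite IH; ring. Qed.

Lemma psum_abs m f : Rabs (psum m f) <= psum m (fun j => Rabs (f j)).
Proof.
  induction m as [|m IH]; simpl; [rewrite Rabs_R0; lra|].
  pose proof (Rabs_triang (psum m f) (f m)); lra.
Qed.

Fixpoint variation (f : R -> R) (l : list R) : R :=
  match l with
  | x :: (y :: _) as l' => Rabs (f y - f x) + variation f l'
  | _ => 0
  end.

Fixpoint insert (x : R) (l : list R) : list R :=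
  match l with
  | nil => x :: nil
  | y :: l' => if Rle_dec x y then x :: l else y :: insert x l'
  end.

Definition isort (l : list R) : list R := fold_right insert nil l.

Lemma variation_cons f x y l : variation f (x :: y :: l) = Rabs (f y - f x) + variation f (y :: l).
Proof. reflexivity. Qed.

Lemma variation_cons_ge f x l : variation f l <= variation f (x :: l).
Proof.
  destruct l as [|y l]; simpl; [lra|].
  pose proof (Rabs_pos (f y - f x)); lra.
Qed.

Lemma variation_skip f x y l : variation f (x :: l) <= variation f (x :: y :: l).
Proof.
  destruct l as [|z l]; rewrite ?variation_cons.
  - simpl; pose proof (Rabs_pos (f y - f x)); lra.
  - replace (f z - f x) with ((f y - f x) + (f z - f y)) by ring.
    pose proof (Rabs_triang (f y - f x) (f z - f y)); lra.
Qed.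

Lemma variation_insert f x l : variation f l <= variation f (insert x l).
Proof.
  induction l as [|y l IH]; [simpl; lra|].
  simpl insert; destruct (Rle_dec x y); [apply variation_cons_ge|].
  destruct l as [|z l]; [simpl; pose proof (Rabs_pos (f x - f y)); lra|].
  simpl insert in *; destruct (Rle_dec x z).
  - apply variation_skip.
  - rewrite !variation_cons; lra.
Qed.

Lemma insert_perm x l : Permutation (x :: l) (insert x l).
Proof.
  induction l as [|y l IH]; simpl; [easy|].
  destruct (Rle_dec x y); [easy|].
  rewrite perm_swap; now constructor.
Qed.

Lemma isort_perm l : Permutation l (isort l).
Proof.
  induction l as [|x l IH]; simpl; [easy|].
  rewrite <- insert_perm; now constructor.
Qed.

Lemma insert_sorted x l : StronglySorted Rle l -> StronglySorted Rle (insert x l).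
Proof.
  induction l as [|y l IH]; simpl; intros H; [repeat constructor|].
  apply StronglySorted_inv in H; destruct H as [H1 H2].
  destruct (Rle_dec x y).
  - constructor; [now constructor|]. constructor; [easy|].
    eapply Forall_impl; [|apply H2]; simpl; intros; lra.
  - constructor; [auto|].
    apply (Permutation_Forall (insert_perm x l)).
    constructor; [lra|easy].
Qed.

Lemma isort_sorted l : StronglySorted Rle (isort l).
Proof. induction l; simpl; [constructor|now apply insert_sorted]. Qed.

Lemma isort_id l : StronglySorted Rle l -> isort l = l.
Proof.
  induction l as [|x l IH]; simpl; intros H; [easy|].
  apply StronglySorted_inv in H; destruct H as [H1 H2].
  rewrite IH by easy. destruct l as [|y l]; [easy|].
  simpl; destruct (Rle_dec x y); [easy|].
  inversion H2; subst; contradiction.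
Qed.

Lemma insert_comm x y l : insert x (insert y l) = insert y (insert x l).
Proof.
  induction l as [|z l IH]; simpl.
  - destruct (Rle_dec x y), (Rle_dec y x); try easy; [|lra].
    replace y with x by lra; easy.
  - destruct (Rle_dec y z), (Rle_dec x z); simpl;
      destruct (Rle_dec x y), (Rle_dec y x);
      repeat match goal with |- context [Rle_dec ?a ?b] => destruct (Rle_dec a b) end;
      try easy; try lra; try (replace y with x by lra; easy); now rewrite IH.
Qed.

Lemma isort_permutation l l' : Permutation l l' -> isort l = isort l'.
Proof.
  induction 1; simpl; [easy|congruence|apply insert_comm|congruence].
Qed.

Lemma variation_isort_app f l l' : StronglySorted Rle l' -> variation f l' <= variation f (isort (l ++ l')).
Proof.
  intros H; induction l as [|x l IH]; simpl.
  - rewrite isort_id; [lra|easy].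
  - eapply Rle_trans; [apply IH|apply variation_insert].
Qed.

Lemma variation_isort_concat f (L : list (list R)) l :
  In l L -> StronglySorted Rle l -> variation f l <= variation f (isort (concat L)).
Proof.
  intros Hl Hs; destruct (in_split _ _ Hl) as [L1 [L2 ->]].
  rewrite concat_app; simpl.
  rewrite (isort_permutation _ ((concat L1 ++ concat L2) ++ l)).
  - now apply variation_isort_app.
  - rewrite <- app_assoc; apply Permutation_app_head, Permutation_app_comm.
Qed.

(** Increments of [G] add up along a sorted list, so the bound on a single step passes to the whole
    list at once for all [j]. *)
Lemma psum_variation_le (m : nat) (E : nat -> R -> R) (G : R -> R) (t : R) (P : list R) :
  (forall a b, 0 <= a <= b -> b <= t -> psum m (fun j => Rabs (E j b - E j a)) <= G b - G a) ->
  0 <= t -> StronglySorted Rle P -> (forall x, In x P -> 0 <= x <= t) ->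
  psum m (fun j => variation (E j) P) <= G t - G 0.
Proof.
  intros H Ht HP Hin.
  (* Monotonicity of [G] covers the stretches from [0] to the first point of [P] and from the last
     one to [t]. *)
  assert (G0 : forall a b, 0 <= a <= b -> b <= t -> G a <= G b).
  { intros a b H1 H2; specialize (H a b H1 H2).
    assert (0 <= psum m (fun j => Rabs (E j b - E j a))); [|lra].
    rewrite <- (Rmult_0_r (INR m)), <- psum_const.
    apply psum_le; intros; apply Rabs_pos. }
  assert (Hx : forall x P, StronglySorted Rle (x :: P) -> (forall y, In y (x :: P) -> 0 <= y <= t) ->
     psum m (fun j => variation (E j) (x :: P)) <= G t - G x).
  { clear P HP Hin; intros x P; revert x; induction P as [|y P IH]; intros x HP Hin.
    - simpl. rewrite psum_const. pose proof (Hin x (or_introl eq_refl)).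
      specialize (G0 x t); lra.
    - pose proof (Hin x (or_introl eq_refl)).
      pose proof (Hin y (or_intror (or_introl eq_refl))).
      apply StronglySorted_inv in HP; destruct HP as [HP1 HP2].
      assert (x <= y) by (inversion HP2; easy).
      specialize (IH y HP1 (fun z hz => Hin z (or_intror hz))).
      specialize (H x y).
      rewrite (psum_ext m _ (fun j => Rabs (E j y - E j x) + variation (E j) (y :: P))) by easy.
      rewrite psum_plus; lra. }
  destruct P as [|x P].
  - simpl; rewrite psum_const. specialize (G0 0 t); lra.
  - specialize (Hx x P HP Hin). pose proof (Hin x (or_introl eq_refl)).
    specialize (G0 0 x); lra.
Qed.

(* The chains are merged into one sorted list: inserting points never decreases a variation. *)
Lemma psum_chain_le (m : nat) (E : nat -> R -> R) (G : R -> R) (t : R)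
    (v : nat -> R) :
  (forall a b, 0 <= a <= b -> b <= t -> psum m (fun j => Rabs (E j b - E j a)) <= G b - G a) ->
  0 <= t ->
  (forall j, (j < m)%nat -> exists l, StronglySorted Rle l /\
     (forall x, In x l -> 0 <= x <= t) /\ v j <= variation (E j) l) ->
  psum m v <= G t - G 0.
Proof.
  intros H Ht Hl.
  assert (exists F : nat -> list R, forall j, (j < m)%nat -> StronglySorted Rle (F j) /\
     (forall x, In x (F j) -> 0 <= x <= t) /\ v j <= variation (E j) (F j)) as [F HF].
  { apply (functional_choice (fun j l => (j < m)%nat -> StronglySorted Rle l /\
     (forall x, In x l -> 0 <= x <= t) /\ v j <= variation (E j) l)).
    intros j; destruct (Compare_dec.lt_dec j m) as [Hj|Hj].
    - destruct (Hl j Hj) as [l H1]; now exists l.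
    - exists nil; easy. }
  set (P := isort (concat (map F (seq 0 m)))).
  apply Rle_trans with (psum m (fun j => variation (E j) P)).
  - apply psum_le; intros j Hj; destruct (HF j Hj) as [H1 [_ H2]].
    eapply Rle_trans; [apply H2|]. apply variation_isort_concat; [|easy].
    apply in_map, in_seq; lia.
  - apply psum_variation_le; [easy|easy|apply isort_sorted|].
    intros x Hx. apply (Permutation_in _ (Permutation_sym (isort_perm _))) in Hx.
    apply in_concat in Hx; destruct Hx as [l [H1 H2]].
    apply in_map_iff in H1; destruct H1 as [j [<- Hj]].
    apply in_seq in Hj. apply (HF j); [lia|easy].
Qed.

(** The error is compared with [eta * h] rather than a quotient with [eta], so that no division
    enters. One side suffices for monotonicity and exists even at the corners of a distance
    function. *)
Definition right_derive (f : R -> R) (s l : R) : Prop :=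
  forall eta, 0 < eta -> exists delta, 0 < delta /\
    forall h, 0 < h < delta -> Rabs (f (s + h) - f s - l * h) <= eta * h.

Lemma is_derive_eps (f : R -> R) s l : is_derive f s l ->
  forall eta, 0 < eta -> exists delta, 0 < delta /\
    forall h, Rabs h < delta -> Rabs (f (s + h) - f s - l * h) <= eta * Rabs h.
Proof.
  intros H eta He. apply is_derive_Reals in H.
  destruct (H eta He) as [[d Hd] H1]; exists d; split; [easy|].
  intros h Hh. destruct (Req_dec h 0) as [->|Hn].
  - rewrite Rplus_0_r, Rabs_R0. replace (f s - f s - l * 0) with 0 by ring.
    rewrite Rabs_R0; lra.
  - specialize (H1 h Hn Hh).
    replace (f (s + h) - f s - l * h) with (((f (s + h) - f s) / h - l) * h) by (field; easy).
    rewrite Rabs_mult. apply Rmult_le_compat_r; [apply Rabs_pos|lra].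
Qed.

Lemma is_derive_right f s l : is_derive f s l -> right_derive f s l.
Proof.
  intros H eta He. destruct (is_derive_eps f s l H eta He) as [d [H1 H2]].
  exists d; split; [easy|]. intros h Hh.
  specialize (H2 h). rewrite (Rabs_right h) in H2 by lra. apply H2; lra.
Qed.

Lemma right_derive_plus f g s l k :
  right_derive f s l -> right_derive g s k -> right_derive (fun r => f r + g r) s (l + k).
Proof.
  intros Hf Hg eta He.
  destruct (Hf (eta / 2)) as [d1 [H1 H2]]; [lra|].
  destruct (Hg (eta / 2)) as [d2 [H3 H4]]; [lra|].
  exists (Rmin d1 d2); split; [now apply Rmin_pos|]. intros h Hh.
  pose proof (Rmin_l d1 d2); pose proof (Rmin_r d1 d2).
  specialize (H2 h ltac:(lra)); specialize (H4 h ltac:(lra)).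
  replace (f (s + h) + g (s + h) - (f s + g s) - (l + k) * h) with
    ((f (s + h) - f s - l * h) + (g (s + h) - g s - k * h)) by ring.
  eapply Rle_trans; [apply Rabs_triang|]; lra.
Qed.

Lemma right_derive_scal c f s l :
  right_derive f s l -> right_derive (fun r => c * f r) s (c * l).
Proof.
  intros Hf eta He.
  assert (Hc : 0 < Rabs c + 1) by (pose proof (Rabs_pos c); lra).
  destruct (Hf (eta / (Rabs c + 1))) as [d [H1 H2]]; [now apply Rdiv_lt_0_compat|].
  exists d; split; [easy|]; intros h Hh; specialize (H2 h Hh).
  replace (c * f (s + h) - c * f s - c * l * h) with (c * (f (s + h) - f s - l * h)) by ring.
  rewrite Rabs_mult.
  apply Rle_trans with ((Rabs c + 1) * (eta / (Rabs c + 1) * h)).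
  - apply Rmult_le_compat; [apply Rabs_pos|apply Rabs_pos|lra|easy].
  - right; field; lra.
Qed.

Lemma right_derive_ext f g s l :
  (forall r, f r = g r) -> right_derive f s l -> right_derive g s l.
Proof. intros H Hf eta He; destruct (Hf eta He) as [d Hd]; exists d; now setoid_rewrite <- H. Qed.

Lemma right_derive_psum m (f : nat -> R -> R) s (l : nat -> R) :
  (forall j, (j < m)%nat -> right_derive (f j) s (l j)) ->
  right_derive (fun r => psum m (fun j => f j r)) s (psum m l).
Proof.
  induction m as [|m IH]; simpl; intros H.
  - intros eta He; exists 1; split; [lra|]; intros h Hh.
    replace (0 - 0 - 0 * h) with 0 by ring; rewrite Rabs_R0; nra.
  - apply right_derive_plus; auto with arith.
Qed.

(** Real induction: the set of points up to which [f] grows with slope at most [eta] is closed by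
    continuity, and it can be prolonged to the right by the derivative condition, so it reaches
    [b]. *)
Lemma right_derive_nonpos_decr (f : R -> R) (a b : R) :
  a <= b -> (forall s, a <= s <= b -> continuity_pt f s) ->
  (forall s, a <= s < b -> exists l, l <= 0 /\ right_derive f s l) -> f b <= f a.
Proof.
  intros Hab Hc Hd.
  apply Rnot_lt_le; intros Hlt.
  (* Small enough that slope [eta] on [[a, b]] cannot produce the assumed growth; the added 1 keeps
     the denominator positive when [a = b]. *)
  set (eta := (f b - f a) / (2 * (b - a + 1))).
  assert (He : 0 < eta) by (apply Rdiv_lt_0_compat; lra).
  assert (He2 : eta * (b - a) < f b - f a).
  { apply Rlt_le_trans with (eta * (2 * (b - a + 1))); [nra|]. unfold eta; right; field; lra. }
  set (P := fun x => a <= x <= b /\ forall r, a <= r <= x -> f r - f a <= eta * (r - a)).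
  destruct (completeness P) as [c [Hc1 Hc2]].
  { exists b; intros x [Hx _]; lra. }
  { exists a; split; [lra|]. intros r Hr; replace r with a by lra; lra. }
  assert (Hca : a <= c <= b).
  { split; [apply Hc1; split; [lra|intros r Hr; replace r with a by lra; lra]
           |apply Hc2; intros x [Hx _]; lra]. }
  assert (Hlow : forall r, a <= r < c -> f r - f a <= eta * (r - a)).
  { intros r Hr. apply Rnot_lt_le; intros Hn.
    assert (c <= r); [|lra]. apply Hc2; intros x [Hx1 Hx2].
    apply Rnot_lt_le; intros Hn2. specialize (Hx2 r); lra. }
  assert (Hcc : f c - f a <= eta * (c - a)).
  { destruct (Req_dec c a) as [->|Hne]; [lra|].
    apply Rnot_lt_le; intros Hn.
    destruct (Hc c Hca ((f c - f a - eta * (c - a)) / 2)) as [d [Hd1 Hd2]]; [lra|].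
    set (r := Rmax a (c - d / 2)).
    assert (Hr : a <= r < c /\ c - d / 2 <= r).
    { unfold r; split; [split|]; [apply Rmax_l| |apply Rmax_r]. apply Rmax_lub_lt; lra. }
    specialize (Hlow r (proj1 Hr)).
    specialize (Hd2 r). simpl in Hd2; unfold Rdist in Hd2.
    assert (Hd3 : Rabs (f r - f c) < (f c - f a - eta * (c - a)) / 2).
    { apply Hd2; split; [split; [easy|lra]|]. rewrite Rabs_left; lra. }
    apply Rabs_def2 in Hd3. nra. }
  destruct (Req_dec c b) as [->|Hne]; [lra|].
  destruct (Hd c) as [l [Hl1 Hl2]]; [lra|].
  destruct (Hl2 eta He) as [d [Hd1 Hd2]].
  set (h := Rmin (d / 2) (b - c)).
  assert (Hh : 0 < h /\ h < d /\ h <= b - c).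
  { unfold h; pose proof (Rmin_l (d / 2) (b - c)); pose proof (Rmin_r (d / 2) (b - c)).
    split; [apply Rmin_pos|]; lra. }
  assert (Hbad : c + h <= c); [|lra].
  apply Hc1; split; [lra|]. intros r Hr.
  destruct (Rle_dec r c) as [Hrc|Hrc].
  - destruct (Req_dec r c) as [->|]; [easy|apply Hlow; lra].
  - specialize (Hd2 (r - c) ltac:(lra)). replace (c + (r - c)) with r in Hd2 by ring.
    apply Rabs_le_between in Hd2. nra.
Qed.

(** * Sign changes of quadratics *)

Definition vec : Type := (R * R * R)%type.

Definition dot (u v : vec) : R :=
  let '(u0, u1, u2) := u in let '(v0, v1, v2) := v in u0 * v0 + u1 * v1 + u2 * v2.

Definition nrm (u : vec) : R := sqrt (dot u u).

Definition comb (a : R) (u : vec) (b : R) (v : vec) : vec :=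
  let '(u0, u1, u2) := u in let '(v0, v1, v2) := v in
  (a * u0 + b * v0, a * u1 + b * v1, a * u2 + b * v2).

Definition cross (u v : vec) : vec :=
  let '(u0, u1, u2) := u in let '(v0, v1, v2) := v in
  (u1 * v2 - u2 * v1, u2 * v0 - u0 * v2, u0 * v1 - u1 * v0).

Ltac vec := repeat match goal with u : vec |- _ => destruct u as [[? ?] ?] end;
  unfold dot, comb, cross in *; simpl in *.

Lemma dot_sym u v : dot u v = dot v u.
Proof. vec; ring. Qed.

Lemma dot_comb_l a u b v w : dot (comb a u b v) w = a * dot u w + b * dot v w.
Proof. vec; ring. Qed.

Lemma dot_self_pos u : 0 <= dot u u.
Proof. vec; nra. Qed.

Lemma nrm_pos u : 0 <= nrm u.
Proof. apply sqrt_pos. Qed.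

Lemma nrm_sqr u : nrm u * nrm u = dot u u.
Proof. apply sqrt_sqrt, dot_self_pos. Qed.

Lemma dot_cross u v : dot (cross u v) (cross u v) = dot u u * dot v v - dot u v * dot u v.
Proof. vec; ring. Qed.

Lemma dot_unit_bounds u p : dot u u = 1 -> dot p p = 1 -> -1 <= dot u p <= 1.
Proof.
  intros Hu Hp. pose proof (dot_self_pos (cross u p)) as H.
  rewrite dot_cross, Hu, Hp in H. nra.
Qed.

(** The sum of the coordinate errors dominates their Euclidean norm. Errors are estimated coordinate
    by coordinate below, hence this form of the hypothesis. *)
Lemma nrm_lipschitz (a b : vec) (D : R) :
  (let '(a0, a1, a2) := a in let '(b0, b1, b2) := b in
   Rabs (a0 - b0) + Rabs (a1 - b1) + Rabs (a2 - b2) <= D) -> nrm a <= nrm b + D.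
Proof.
  intros HD. pose proof (nrm_pos b) as Hb. pose proof (nrm_sqr b) as Hb2.
  assert (HD0 : 0 <= D).
  { vec. pose proof (Rabs_pos (r3 - r0)); pose proof (Rabs_pos (r4 - r1)); pose proof (Rabs_pos (r2 - r)). lra. }
  unfold nrm at 1. rewrite <- (sqrt_square (nrm b + D)) by lra. apply sqrt_le_1_alt.
  set (N := nrm b) in *; clearbody N. vec.
  (* Used once per coordinate, this replaces the Cauchy-Schwarz inequality for the mixed term of
     [|b + (a - b)|^2]. *)
  assert (A : forall x y, y * y <= N * N -> y * x <= N * Rabs x).
  { intros x y Hy. apply Rle_trans with (Rabs (y * x)); [apply Rle_abs|].
    rewrite Rabs_mult. apply Rmult_le_compat_r; [apply Rabs_pos|].
    apply Rabs_le_between; nra. }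
  pose proof (A (r3 - r0) r0 ltac:(nra)). pose proof (A (r4 - r1) r1 ltac:(nra)).
  pose proof (A (r2 - r) r ltac:(nra)).
  assert (S : forall x, x * x = Rabs x * Rabs x) by (intros x; rewrite <- Rabs_mult, Rabs_right; nra).
  pose proof (S (r3 - r0)). pose proof (S (r4 - r1)). pose proof (S (r2 - r)).
  pose proof (Rabs_pos (r3 - r0)); pose proof (Rabs_pos (r4 - r1)); pose proof (Rabs_pos (r2 - r)).
  set (x := Rabs (r3 - r0)) in *; set (y := Rabs (r4 - r1)) in *; set (z := Rabs (r2 - r)) in *.
  assert (x * x + y * y + z * z <= D * D) by nra.
  nra.
Qed.

(* The third divided difference of a quadratic is zero. *)
Lemma quadratic_alternation (v0 v1 v2 l0 l1 l2 l3 : R) :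
  l0 < l1 -> l1 < l2 -> l2 < l3 ->
  0 <= v0 + v1 * l0 + v2 * l0 * l0 -> v0 + v1 * l1 + v2 * l1 * l1 <= 0 ->
  0 <= v0 + v1 * l2 + v2 * l2 * l2 -> v0 + v1 * l3 + v2 * l3 * l3 <= 0 ->
  v0 = 0 /\ v1 = 0 /\ v2 = 0.
Proof.
  intros H1 H2 H3 Q0 Q1 Q2 Q3.
  set (q0 := v0 + v1 * l0 + v2 * l0 * l0) in *.
  set (q1 := v0 + v1 * l1 + v2 * l1 * l1) in *.
  set (q2 := v0 + v1 * l2 + v2 * l2 * l2) in *.
  set (q3 := v0 + v1 * l3 + v2 * l3 * l3) in *.
  set (w0 := (l2 - l1) * (l3 - l1) * (l3 - l2)).
  set (w1 := (l2 - l0) * (l3 - l0) * (l3 - l2)).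
  set (w2 := (l1 - l0) * (l3 - l0) * (l3 - l1)).
  set (w3 := (l1 - l0) * (l2 - l0) * (l2 - l1)).
  assert (W0 : 0 < w0) by (unfold w0; repeat apply Rmult_lt_0_compat; lra).
  assert (W1 : 0 < w1) by (unfold w1; repeat apply Rmult_lt_0_compat; lra).
  assert (W2 : 0 < w2) by (unfold w2; repeat apply Rmult_lt_0_compat; lra).
  assert (W3 : 0 < w3) by (unfold w3; repeat apply Rmult_lt_0_compat; lra).
  (* The divided difference with its denominators cleared. Under the sign hypotheses all four signed
     terms are nonnegative, so each vanishes, and a quadratic with three zeros is zero. *)
  assert (I : w0 * q0 - w1 * q1 + w2 * q2 - w3 * q3 = 0).
  { unfold w0, w1, w2, w3, q0, q1, q2, q3; ring. }
  assert (E0 : q0 = 0) by nra. assert (E1 : q1 = 0) by nra. assert (E2 : q2 = 0) by nra.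
  unfold q0, q1, q2 in *; clear - E0 E1 E2 H1 H2.
  assert (F1 : (l1 - l0) * (v1 + v2 * (l0 + l1)) = 0) by nra.
  assert (F2 : (l2 - l1) * (v1 + v2 * (l1 + l2)) = 0) by nra.
  apply Rmult_integral in F1, F2. destruct F1 as [F1|F1], F2 as [F2|F2]; try lra.
  assert (F3 : v2 * (l2 - l0) = 0) by nra.
  apply Rmult_integral in F3; destruct F3 as [F3|F3]; [|lra].
  subst v2. assert (v1 = 0) by lra. subst v1. repeat split; lra.
Qed.

Lemma quadratic_sign_variation (v0 v1 v2 : R) (m : nat) (lam s : nat -> R) :
  ~ (v0 = 0 /\ v1 = 0 /\ v2 = 0) ->
  (forall i j, (i < j <= m)%nat -> lam i < lam j) ->
  (forall j, (j <= m)%nat ->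
     (s j = 1 /\ 0 <= v0 + v1 * lam j + v2 * lam j * lam j) \/
     (s j = -1 /\ v0 + v1 * lam j + v2 * lam j * lam j <= 0)) ->
  psum m (fun j => Rabs (s (S j) - s j)) <= 4.
Proof.
  intros Hv Hl Hs.
  (* The invariant keeps indices that witness the alternations so far. A third change would complete
     four alternating points, against [quadratic_alternation]. *)
  assert (Hi : forall k, (k <= m)%nat ->
    let c := psum k (fun j => Rabs (s (S j) - s j)) in
    c = 0 \/ (c = 2 /\ exists i, (i < k)%nat /\ s i = - s k) \/
    (c = 4 /\ exists i i', (i < i' < k)%nat /\ s i = s k /\ s i' = - s k)).
  { induction k as [|k IH]; intros Hk; [left; reflexivity|].
    specialize (IH ltac:(lia)); simpl in *.
    set (c := psum k (fun j => Rabs (s (S j) - s j))) in *.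
    assert (Hcase : s (S k) = s k \/ (s (S k) = - s k /\ Rabs (s (S k) - s k) = 2)).
    { destruct (Hs k ltac:(lia)) as [[-> _]|[-> _]], (Hs (S k) ltac:(lia)) as [[-> _]|[-> _]].
      - left; easy.
      - right; split; [lra|]. rewrite Rabs_left; lra.
      - right; split; [lra|]. rewrite Rabs_right; lra.
      - left; easy. }
    destruct Hcase as [He|[He Ha]].
    - rewrite He, Rminus_diag, Rabs_R0, Rplus_0_r.
      destruct IH as [IH|[[IH [i [I1 I2]]]|[IH [i [i' [I1 [I2 I3]]]]]]].
      + now left.
      + right; left; split; [easy|]. exists i; split; [lia|easy].
      + right; right; split; [easy|]. exists i, i'; repeat split; try lia; easy.
    - rewrite Ha, He.
      destruct IH as [IH|[[IH [i [I1 I2]]]|[IH [i [i' [I1 [I2 I3]]]]]]].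
      + right; left; split; [lra|]. exists k; split; [lia|lra].
      + right; right; split; [lra|]. exists i, k; repeat split; try lia; lra.
      + exfalso; apply Hv.
        pose proof (Hl i i' ltac:(lia)). pose proof (Hl i' k ltac:(lia)).
        pose proof (Hl k (S k) ltac:(lia)).
        destruct (Hs i ltac:(lia)) as [[A1 B1]|[A1 B1]],
          (Hs i' ltac:(lia)) as [[A2 B2]|[A2 B2]],
          (Hs k ltac:(lia)) as [[A3 B3]|[A3 B3]],
          (Hs (S k) ltac:(lia)) as [[A4 B4]|[A4 B4]]; try lra.
        * apply (quadratic_alternation v0 v1 v2 (lam i) (lam i') (lam k) (lam (S k))); easy.
        * destruct (quadratic_alternation (- v0) (- v1) (- v2) (lam i) (lam i') (lam k) (lam (S k)));
            lra. }
  specialize (Hi m (le_n m)); simpl in Hi.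
  destruct Hi as [->|[[-> _]|[-> _]]]; lra.
Qed.

(** With [(X, Y) = r (cos phi, sin phi)] the linear form is [r sin (th + phi)]. Its sign changes at
    most once on [(0, PI)], and the average of that sign with weight [sin th] is a multiple of
    [cos phi = X / r]. The degenerate case serves a vertex at the moving point or at its antipode:
    the form vanishes there, so a constant sign is allowed and yields [C = 1] or [C = -1]. *)
Lemma cos_as_sign_average (X Y C : R) :
  (0 < X * X + Y * Y /\ C = X / sqrt (X * X + Y * Y)) \/
  (X = 0 /\ Y = 0 /\ (C = 1 \/ C = -1)) ->
  exists s : R -> R,
    (forall th, 0 < th < PI -> (s th = 1 /\ 0 <= X * sin th + Y * cos th) \/
                               (s th = -1 /\ X * sin th + Y * cos th <= 0)) /\
    is_RInt (fun th => sin th * s th) 0 PI (2 * C).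
Proof.
  assert (IS : forall a b, is_RInt sin a b (cos a - cos b)).
  { intros a b. replace (cos a - cos b) with (minus (- cos b) (- cos a))
      by (unfold minus, plus, opp; simpl; ring).
    apply (is_RInt_derive (fun x => - cos x) sin).
    - intros x _; auto_derive; [easy|ring].
    - intros x _; apply continuity_pt_filterlim, continuity_sin. }
  assert (IC : forall a b c, is_RInt (fun th => sin th * c) a b (c * (cos a - cos b))).
  { intros a b c. apply (is_RInt_ext (fun th => scal c (sin th))).
    - intros; unfold scal; simpl; unfold mult; simpl; ring.
    - apply (is_RInt_scal (V := R_NormedModule)), IS. }
  assert (Main : forall X Y, 0 <= Y -> 0 < X * X + Y * Y ->
    exists s : R -> R,
    (forall th, 0 < th < PI -> (s th = 1 /\ 0 <= X * sin th + Y * cos th) \/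
                               (s th = -1 /\ X * sin th + Y * cos th <= 0)) /\
    is_RInt (fun th => sin th * s th) 0 PI (2 * (X / sqrt (X * X + Y * Y)))).
  { clear X Y C; intros X Y HY HXY.
    set (r := sqrt (X * X + Y * Y)).
    assert (Hr : 0 < r) by now apply sqrt_lt_R0.
    assert (Hr2 : r * r = X * X + Y * Y) by (apply sqrt_sqrt; lra).
    (* The place of the sign change, [PI - phi] with [phi] in [[0, PI]], since [Y] is nonnegative
       here. *)
    set (t0 := acos (- (X / r))).
    assert (HX : -1 <= - (X / r) <= 1).
    { assert (Hq : X / r * r = X) by (field; lra). set (q := X / r) in *; clearbody q.
      assert (q * q * (r * r) <= 1 * (r * r)) by nra.
      assert (q * q <= 1) by (apply Rmult_le_reg_r with (r * r); nra). split; nra. }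
    pose proof (acos_bound (- (X / r))) as Ht.
    assert (Hc : cos t0 = - (X / r)) by (apply cos_acos; easy).
    assert (Hs : sin t0 = Y / r).
    { unfold t0; rewrite sin_acos by easy.
      replace (1 - Rsqr (- (X / r))) with (Rsqr (Y / r)).
      - apply sqrt_Rsqr. apply Rmult_le_pos; [easy|]. left; now apply Rinv_0_lt_compat.
      - unfold Rsqr. apply Rmult_eq_reg_r with (r * r); [|nra].
        transitivity (Y * Y); [field; lra|]. transitivity (r * r - X * X); [lra|field; lra]. }
    assert (E : forall th, X * sin th + Y * cos th = r * sin (t0 - th)).
    { intros th; rewrite sin_minus, Hc, Hs; field; lra. }
    exists (fun th => if Rlt_dec th t0 then 1 else -1); split.
    - intros th Hth; rewrite E; destruct (Rlt_dec th t0) as [H|H]; [left|right]; split; try easy.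
      + apply Rmult_le_pos; [lra|]. apply sin_ge_0; fold t0 in Ht; lra.
      + replace (t0 - th) with (- (th - t0)) by ring. rewrite sin_neg.
        assert (0 <= sin (th - t0)) by (apply sin_ge_0; fold t0 in Ht; lra). nra.
    - fold t0 in Ht.
      replace (2 * (X / r)) with (plus (1 * (cos 0 - cos t0)) (-1 * (cos t0 - cos PI)))
        by (unfold plus; simpl; rewrite cos_0, cos_PI, Hc; ring).
      apply (is_RInt_Chasles (V := R_NormedModule)) with t0.
      + apply (is_RInt_ext (fun th => sin th * 1)); [|apply IC].
        intros x; rewrite Rmin_left, Rmax_right by lra; intros Hx.
        destruct (Rlt_dec x t0); [easy|lra].
      + apply (is_RInt_ext (fun th => sin th * -1)); [|apply IC].
        intros x; rewrite Rmin_left, Rmax_right by lra; intros Hx.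
        destruct (Rlt_dec x t0); [lra|easy]. }
  intros [[H ->]|[-> [-> HC]]].
  - destruct (Rle_dec 0 Y) as [HY|HY]; [now apply Main|].
    destruct (Main (- X) (- Y)) as [s [H1 H2]]; [lra|nra|].
    exists (fun th => - s th); split.
    + intros th Hth; destruct (H1 th Hth) as [[-> B]|[-> B]]; [right|left]; lra.
    + apply (is_RInt_ext (fun th => opp (sin th * s th))).
      * intros; unfold opp; simpl; ring.
      * replace (2 * (X / sqrt (X * X + Y * Y))) with
          (opp (2 * (- X / sqrt (- X * - X + - Y * - Y)))).
        -- now apply (is_RInt_opp (V := R_NormedModule)).
        -- unfold opp; simpl. replace (- X * - X + - Y * - Y) with (X * X + Y * Y) by ring.
           field. apply Rgt_not_eq, sqrt_lt_R0; easy.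
  - exists (fun _ => C); split.
    + intros th _; destruct HC as [->| ->]; [left|right]; split; lra.
    + replace (2 * C) with (C * (cos 0 - cos PI)) by (rewrite cos_0, cos_PI; ring). apply IC.
Qed.

Lemma is_RInt_psum (m : nat) (f : nat -> R -> R) (a b : R) (l : nat -> R) :
  (forall j, (j < m)%nat -> is_RInt (f j) a b (l j)) ->
  is_RInt (fun x => psum m (fun j => f j x)) a b (psum m l).
Proof.
  induction m as [|m IH]; simpl; intros H.
  - pose proof (is_RInt_const (V := R_NormedModule) a b 0) as H0.
    unfold scal in H0; simpl in H0; unfold mult in H0; simpl in H0.
    now rewrite Rmult_0_r in H0.
  - apply (is_RInt_plus (V := R_NormedModule)); auto with arith.
Qed.

(** The points [kap j * (1, lam j, lam j ^ 2)] lie on the boundary of the cone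
    [x0 x2 > x1 ^ 2, x2 > 0]. *)
Definition cone_chain (m : nat) (p : nat -> vec) (lam kap : nat -> R) : Prop :=
  (forall i j, (i < j <= m)%nat -> lam i < lam j) /\
  (forall j, (j <= m)%nat -> 0 < kap j /\ dot (p j) (p j) = 1 /\
     p j = (kap j, kap j * lam j, kap j * (lam j * lam j))).

(** [l] is the right derivative of the spherical distance to [p] at a point passing through
    [u] with velocity [w].  At [u = p] it is [nrm w] and at [u = - p] it is [- nrm w]; the
    variation bound below holds for either sign, because there [p] is orthogonal to every
    linear form on the tangent plane at [u]. *)
Definition dist_rate (u w p : vec) (l : R) : Prop :=
  (dot u p * dot u p < 1 /\ l = - dot w p / sqrt (1 - dot u p * dot u p)) \/
  (dot u p * dot u p = 1 /\ (l = nrm w \/ l = - nrm w)).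

(** Away from the vertices [l j] is [- nrm w] times the cosine of the angle, in the tangent plane at
    [u], between [w] and the direction of [p j]. The multipliers [eps] stand for the signs of the
    increments; keeping them free makes the estimate linear in [l], so that it commutes with
    derivatives and integrals. *)
Lemma dist_rate_variation (m : nat) (p : nat -> vec) (lam kap : nat -> R) (u w : vec)
    (l eps : nat -> R) :
  cone_chain m p lam kap -> dot u u = 1 -> dot u w = 0 ->
  (forall j, (j <= m)%nat -> dist_rate u w (p j) (l j)) ->
  (forall j, Rabs (eps j) <= 1) ->
  psum m (fun j => eps j * (l (S j) - l j)) <= 4 * nrm w.
Proof.
  intros [Hlam Hp] Hu Huw Hl Heps.
  pose proof (nrm_pos w) as Hw0. pose proof (nrm_sqr w) as Hw2.
  destruct (Req_dec (nrm w) 0) as [Hw|Hw].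
  { rewrite Hw in *. rewrite (psum_ext m _ (fun _ => 0)); [rewrite psum_const; lra|].
    assert (Z : forall j, (j <= m)%nat -> l j = 0).
    { intros j Hj; destruct (Hl j Hj) as [[H ->]|[_ [->| ->]]]; try (rewrite Hw; ring).
      assert (dot w (p j) = 0); [|rewrite H0; unfold Rdiv; ring].
      clear - Hw2. destruct w as [[w0 w1] w2], (p j) as [[p0 p1] p2]. unfold dot in *.
      assert (w0 = 0) by nra. assert (w1 = 0) by nra. assert (w2 = 0) by nra. subst; ring. }
    intros j Hj. rewrite !Z by lia; ring. }
  assert (Hwp : 0 < nrm w) by lra.
  set (b := cross u w).
  (* Pythagoras in the orthogonal frame [u], [w], [b], multiplied by [nrm w ^ 2]. It shows that
     [(dot w q, dot b q)] has length [nrm w * sqrt (1 - dot u q ^ 2)] for a unit vector [q]. *)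
  assert (Hdec : forall q : vec, dot q q * (nrm w * nrm w) =
     dot u q * dot u q * (nrm w * nrm w) + dot w q * dot w q + dot b q * dot b q).
  { intros q. rewrite Hw2. unfold b. clear - Hu Huw.
    assert (I : dot u u * dot q q * dot w w - dot u u * dot w q * dot w q
      - dot u q * dot u q * dot w w - dot (cross u w) q * dot (cross u w) q
      = dot u w * (dot u w * dot q q - 2 * dot u q * dot w q)) by (vec; ring).
    rewrite Huw, Hu in I. lra. }
  assert (exists s : nat -> R -> R, forall j, (j <= m)%nat ->
    (forall th, 0 < th < PI ->
       (s j th = 1 /\ 0 <= dot w (p j) * sin th + dot b (p j) * cos th) \/
       (s j th = -1 /\ dot w (p j) * sin th + dot b (p j) * cos th <= 0)) /\
    is_RInt (fun th => sin th * s j th) 0 PI (2 * (- l j / nrm w))) as [s Hs].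
  { apply (functional_choice (fun j sj => (j <= m)%nat ->
    (forall th, 0 < th < PI ->
       (sj th = 1 /\ 0 <= dot w (p j) * sin th + dot b (p j) * cos th) \/
       (sj th = -1 /\ dot w (p j) * sin th + dot b (p j) * cos th <= 0)) /\
    is_RInt (fun th => sin th * sj th) 0 PI (2 * (- l j / nrm w)))).
    intros j. destruct (Compare_dec.le_dec j m) as [Hj|Hj]; [|exists (fun _ => 0); easy].
    destruct (cos_as_sign_average (dot w (p j)) (dot b (p j)) (- l j / nrm w)) as [sj H].
    - specialize (Hdec (p j)). destruct (Hp j Hj) as [_ [Hpj _]]. rewrite Hpj in Hdec.
      destruct (Hl j Hj) as [[H1 H2]|[H1 H2]].
      + left.
        replace (dot w (p j) * dot w (p j) + dot b (p j) * dot b (p j)) with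
          ((1 - dot u (p j) * dot u (p j)) * (nrm w * nrm w)) by lra.
        split; [apply Rmult_lt_0_compat; nra|].
        rewrite sqrt_mult, sqrt_square by nra. rewrite H2; field; split; [easy|].
        apply Rgt_not_eq, sqrt_lt_R0; lra.
      + right. rewrite H1 in Hdec. split; [nra|split; [nra|]].
        destruct H2 as [->| ->]; [right|left]; field; easy.
    - now exists sj. }
  assert (HI : is_RInt (fun th => psum m (fun j => eps j * (sin th * s (S j) th - sin th * s j th)))
     0 PI (psum m (fun j => eps j * (2 * (- l (S j) / nrm w) - 2 * (- l j / nrm w))))).
  { apply is_RInt_psum; intros j Hj.
    apply (is_RInt_scal (V := R_NormedModule)).
    apply (is_RInt_minus (V := R_NormedModule)); apply Hs; lia. }
  rewrite (psum_ext m (fun j => eps j * (2 * (- l (S j) / nrm w) - 2 * (- l j / nrm w)))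
    (fun j => - 2 / nrm w * (eps j * (l (S j) - l j)))) in HI by (intros; field; easy).
  rewrite psum_scal in HI.
  set (V := psum m (fun j => eps j * (l (S j) - l j))) in *.
  assert (HS : is_RInt (fun th => - 4 * sin th) 0 PI (- 8)).
  { replace (- 8) with (minus (4 * cos PI) (4 * cos 0))
      by (unfold minus, plus, opp; simpl; rewrite cos_0, cos_PI; ring).
    apply (is_RInt_derive (fun x => 4 * cos x) (fun x => - 4 * sin x)).
    - intros x _; auto_derive; [easy|ring].
    - intros x _. apply continuity_pt_filterlim.
      apply continuity_pt_mult; [apply continuity_pt_const; easy|apply continuity_sin]. }
  assert (HV : - 8 <= - 2 / nrm w * V).
  { refine (is_RInt_le _ _ _ _ _ _ _ HS HI _); [left; apply PI_RGT_0|].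
    intros th Hth. assert (Hsin : 0 < sin th) by (apply sin_gt_0; lra).
    assert (HA : psum m (fun j => Rabs (s (S j) th - s j th)) <= 4).
    (* For a fixed [th] all the signs are those of one nonzero linear form [v]. On the ray through
       [(1, lam j, lam j ^ 2)] it is a positive multiple of a quadratic in [lam j]. *)
    { set (v := comb (sin th) w (cos th) b).
      assert (Hvd : forall q, dot v q = dot w q * sin th + dot b q * cos th).
      { intros q; unfold v; rewrite dot_comb_l; ring. }
      assert (Hvv : 0 < dot v v).
      { assert (dot v v = nrm w * nrm w); [|nra].
        assert (I : dot v v = sin th * sin th * dot w w + cos th * cos th * dot b b
          + 2 * sin th * cos th * dot w b) by (unfold v; clear; vec; ring).
        assert (I2 : dot w b = 0) by (unfold b; clear; vec; ring).
        assert (I3 : dot b b = dot w w) by (unfold b; rewrite dot_cross, Hu, Huw; ring).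
        rewrite I, I2, I3, Hw2. pose proof (sin2_cos2 th) as Hsc. unfold Rsqr in Hsc. nra. }
      clearbody v. destruct v as [[v0 v1] v2].
      apply (quadratic_sign_variation v0 v1 v2 m lam (fun j => s j th)).
      - intros [-> [-> ->]]; unfold dot in Hvv; lra.
      - easy.
      - intros j Hj. destruct (Hs j Hj) as [Hs1 _]. specialize (Hs1 th).
        specialize (Hs1 Hth).
          destruct (Hp j Hj) as [Hk [_ Hpj]].
        assert (Hq : dot (v0, v1, v2) (p j) = kap j * (v0 + v1 * lam j + v2 * lam j * lam j)).
        { rewrite Hpj; unfold dot; ring. }
        rewrite <- Hvd, Hq in Hs1.
        destruct Hs1 as [[A B]|[A B]]; [left|right]; split; try easy; nra. }
    rewrite (psum_ext m _ (fun j => sin th * (eps j * (s (S j) th - s j th)))) by (intros; ring).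
    rewrite psum_scal.
    assert (- 4 <= psum m (fun j => eps j * (s (S j) th - s j th))); [|nra].
    apply Rle_trans with (- psum m (fun j => Rabs (s (S j) th - s j th))); [lra|].
    apply Rle_trans with (- psum m (fun j => Rabs (eps j * (s (S j) th - s j th)))).
    - apply Ropp_le_contravar, psum_le; intros j _. rewrite Rabs_mult.
      rewrite <- (Rmult_1_l (Rabs (s (S j) th - s j th))) at 2.
      apply Rmult_le_compat_r; [apply Rabs_pos|apply Heps].
    - pose proof (psum_abs m (fun j => eps j * (s (S j) th - s j th))) as HA2.
      apply Rabs_le_between in HA2. lra. }
  apply Rmult_le_reg_l with (2 / nrm w); [apply Rdiv_lt_0_compat; lra|].
  replace (2 / nrm w * (4 * nrm w)) with 8 by (field; easy).
  replace (- 2 / nrm w * V) with (- (2 / nrm w * V)) in HV by (field; easy). lra.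
Qed.

(** * Upper bound for the variation *)

(** The derivative is tested against fixed vectors, so that calculus of real functions is enough for
    a path in space. *)
Definition vderive (U : R -> vec) (s : R) (w : vec) : Prop :=
  forall p, is_derive (fun r => dot (U r) p) s (dot w p).

(** An angle [t] has chord [2 sin (t / 2)], of square [2 - 2 cos t]. Unlike [acos] at 1, [asin] is
    differentiable at 0, so the chord formula controls small distances. *)
Lemma acos_chord c : -1 <= c <= 1 -> acos c = 2 * asin (sqrt (2 - 2 * c) / 2).
Proof.
  intros Hc. pose proof (acos_bound c) as Hb.
  set (t := acos c) in *. assert (Ht : cos t = c) by now apply cos_acos.
  assert (Hs : 0 <= sin (t / 2)) by (apply sin_ge_0; lra).
  replace (2 - 2 * c) with ((2 * sin (t / 2)) * (2 * sin (t / 2))).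
  - rewrite sqrt_square by lra. replace (2 * sin (t / 2) / 2) with (sin (t / 2)) by field.
    rewrite asin_sin by lra. field.
  - rewrite <- Ht. replace t with (2 * (t / 2)) at 3 by field. rewrite cos_2a_sin. ring.
Qed.

Lemma sum_sqr_eq_0 x y z : x * x + y * y + z * z = 0 -> x = 0 /\ y = 0 /\ z = 0.
Proof.
  intros H. pose proof (Rle_0_sqr x) as Hx. pose proof (Rle_0_sqr y) as Hy.
  pose proof (Rle_0_sqr z) as Hz. unfold Rsqr in *. repeat split; apply Rsqr_0_uniq; unfold Rsqr; lra.
Qed.

Lemma continuous_Rmax_0 r : continuous (Rmax 0) r.
Proof.
  apply (continuous_ext (fun r => / 2 * (r + Rabs r))).
  - intros x; unfold Rabs, Rmax; destruct (Rcase_abs x), (Rle_dec 0 x); lra.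
  - apply (continuous_mult (K := R_AbsRing)); [apply continuous_const|].
    apply (continuous_plus (V := R_NormedModule)); [apply continuous_id|apply continuous_Rabs].
Qed.

Lemma continuity_pt_acos c : -1 <= c <= 1 -> continuity_pt acos c.
Proof.
  intros Hc0; assert (H1 : continuity_pt acos 1).
  { clear c Hc0. apply continuity_pt_ext_loc with (fun c => 2 * asin (sqrt (2 - 2 * c) / 2)).
    - exists (mkposreal 1 Rlt_0_1). intros c Hc.
      unfold ball in Hc; simpl in Hc; unfold AbsRing_ball, abs, minus, plus, opp in Hc; simpl in Hc.
      apply Rabs_def2 in Hc. destruct (Rle_dec c 1) as [Hc1|Hc1].
      + symmetry; apply acos_chord; lra.
      (* Beyond 1 the two sides agree through default values: the square root of a negative number
         is 0, and [acos] is constantly 0. *)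
      + rewrite sqrt_neg_0 by lra. replace (0 / 2) with 0 by field. rewrite asin_0.
        unfold acos; destruct (Rle_dec c (-1)); [lra|]. destruct (Rle_dec 1 c); lra.
    - apply continuity_pt_mult; [apply continuity_pt_const; easy|].
      apply (continuity_pt_comp (fun c => sqrt (2 - 2 * c) / 2) asin).
      + apply continuity_pt_mult; [|apply continuity_pt_const; easy].
        apply (continuity_pt_comp (fun c => 2 - 2 * c) sqrt).
        * reg.
        * apply continuity_pt_sqrt; lra.
      + replace (2 - 2 * 1) with 0 by ring. rewrite sqrt_0. replace (0 / 2) with 0 by field.
        apply derivable_continuous_pt, derivable_pt_asin; lra. }
  destruct (Req_dec c 1) as [->|Hn1]; [easy|].
  destruct (Req_dec c (-1)) as [->|Hn2].
  - apply continuity_pt_ext with (fun c => PI - acos (- c)).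
    + intros x; rewrite acos_opp; ring.
    + apply continuity_pt_minus; [apply continuity_pt_const; easy|].
      apply (continuity_pt_comp Ropp acos); [reg|]. now replace (- (-1)) with 1 by ring.
  - apply derivable_continuous_pt, derivable_pt_acos; lra.
Qed.

(** The path starts at [p], so after time [h] its chord to [p] is [nrm w * h] up to [o(h)], and
    chord and arc agree to first order. *)
Lemma dist_right_derive_hit (U : R -> vec) (s : R) (w p : vec) :
  0 <= s -> (forall r, 0 <= r -> dot (U r) (U r) = 1) -> vderive U s w ->
  dot p p = 1 -> dot (U s) p = 1 ->
  right_derive (fun r => acos (dot (U r) p)) s (nrm w).
Proof.
  intros Hs HU Hd Hp Hsp eta He.
  assert (HUs : U s = p).
  { pose proof (HU s Hs) as Hu. destruct (U s) as [[u0 u1] u2], p as [[p0 p1] p2].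
    unfold dot in *.
    assert (I : (u0 - p0) * (u0 - p0) + (u1 - p1) * (u1 - p1) + (u2 - p2) * (u2 - p2) = 0) by lra.
    destruct (sum_sqr_eq_0 _ _ _ I) as [I0 [I1 I2]].
    replace u0 with p0 by lra. replace u1 with p1 by lra. now replace u2 with p2 by lra. }
  pose proof (nrm_pos w) as Hw.
  (* The chord differs from [nrm w * h] by at most [e1 * h], and the arc from the chord by at most
     [e1 * (nrm w + 1 / 3) * h]; together this is below [e1 * (nrm w + 2) * h]. *)
  set (e1 := Rmin (1 / 3) (eta / (3 * (nrm w + 2)))).
  assert (He1 : 0 < e1 /\ e1 <= 1 / 3 /\ e1 * (nrm w + 2) <= eta / 3).
  { unfold e1. pose proof (Rmin_l (1 / 3) (eta / (3 * (nrm w + 2)))).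
    pose proof (Rmin_r (1 / 3) (eta / (3 * (nrm w + 2)))).
    split; [apply Rmin_pos; [lra|apply Rdiv_lt_0_compat; lra]|split; [easy|]].
    apply Rle_trans with (eta / (3 * (nrm w + 2)) * (nrm w + 2)); [apply Rmult_le_compat_r; lra|].
    right; field; lra. }
  assert (Hasin : is_derive asin 0 1).
  { apply is_derive_Reals. replace 1 with (/ sqrt (1 - Rsqr 0)).
    - assert (H0 : -1 < 0 < 1) by lra. rewrite <- (Rmult_1_l (/ _)).
      apply (derive_pt_eq_1 _ _ _ (derivable_pt_asin 0 H0)), derive_pt_asin.
    - unfold Rsqr. replace (1 - 0 * 0) with 1 by ring. rewrite sqrt_1; field. }
  destruct (is_derive_eps _ _ _ Hasin e1) as [da [Hda1 Hda2]]; [easy|].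
  destruct (is_derive_eps _ _ _ (Hd (1, 0, 0)) (e1 / 3)) as [d0 [Hd01 Hd02]]; [lra|].
  destruct (is_derive_eps _ _ _ (Hd (0, 1, 0)) (e1 / 3)) as [d1 [Hd11 Hd12]]; [lra|].
  destruct (is_derive_eps _ _ _ (Hd (0, 0, 1)) (e1 / 3)) as [d2 [Hd21 Hd22]]; [lra|].
  (* The last entry keeps half the chord within the radius [da] where [asin] is controlled. *)
  set (dl := Rmin (Rmin d0 d1) (Rmin d2 (da / (nrm w + 2)))).
  assert (Hdl : 0 < dl /\ dl <= d0 /\ dl <= d1 /\ dl <= d2 /\ dl * (nrm w + 2) <= da).
  { unfold dl.
    pose proof (Rmin_l (Rmin d0 d1) (Rmin d2 (da / (nrm w + 2)))).
    pose proof (Rmin_r (Rmin d0 d1) (Rmin d2 (da / (nrm w + 2)))).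
    pose proof (Rmin_l d0 d1). pose proof (Rmin_r d0 d1).
    pose proof (Rmin_l d2 (da / (nrm w + 2))). pose proof (Rmin_r d2 (da / (nrm w + 2))).
    assert (0 < da / (nrm w + 2)) by (apply Rdiv_lt_0_compat; lra).
    split; [repeat apply Rmin_pos; easy|]. split; [lra|split; [lra|split; [lra|]]].
    apply Rle_trans with (da / (nrm w + 2) * (nrm w + 2)); [apply Rmult_le_compat_r; lra|].
    right; field; lra. }
  exists dl; split; [easy|]. intros h Hh.
  specialize (Hd02 h). specialize (Hd12 h). specialize (Hd22 h).
  rewrite (Rabs_right h) in Hd02, Hd12, Hd22 by lra.
  specialize (Hd02 ltac:(lra)); specialize (Hd12 ltac:(lra)); specialize (Hd22 ltac:(lra)).
  set (k := sqrt (2 - 2 * dot (U (s + h)) p)).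
  assert (Hcb : -1 <= dot (U (s + h)) p <= 1) by (apply dot_unit_bounds; [apply HU; lra|easy]).
  set (a := comb 1 (U (s + h)) (-1) p). set (b := comb h w 0 p).
  assert (Hk : k = nrm a).
  { unfold k, nrm; f_equal.
    assert (I : dot a a = dot (U (s + h)) (U (s + h)) - 2 * dot (U (s + h)) p + dot p p)
      by (unfold a; clear; set (q := U (s + h)); clearbody q; vec; ring).
    rewrite I, HU, Hp by lra; ring. }
  assert (Hb : nrm b = nrm w * h).
  { unfold nrm. replace (dot b b) with (dot w w * (h * h)) by (unfold b; clear; vec; ring).
    rewrite sqrt_mult, sqrt_square; try nra. apply dot_self_pos. }
  rewrite HUs in Hd02, Hd12, Hd22.
  assert (Hab : nrm a <= nrm b + e1 * h /\ nrm b <= nrm a + e1 * h).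
  { unfold a, b; destruct (U (s + h)) as [[u0 u1] u2], w as [[w0 w1] w2], p as [[p0 p1] p2].
    unfold dot, comb in *.
    assert (A0 : Rabs (u0 - p0 - w0 * h) <= e1 / 3 * h)
      by (eapply Rle_trans; [right|apply Hd02]; f_equal; ring).
    assert (A1 : Rabs (u1 - p1 - w1 * h) <= e1 / 3 * h)
      by (eapply Rle_trans; [right|apply Hd12]; f_equal; ring).
    assert (A2 : Rabs (u2 - p2 - w2 * h) <= e1 / 3 * h)
      by (eapply Rle_trans; [right|apply Hd22]; f_equal; ring).
    split; apply nrm_lipschitz; cbv beta iota.
    - replace (1 * u0 + -1 * p0 - (h * w0 + 0 * p0)) with (u0 - p0 - w0 * h) by ring.
      replace (1 * u1 + -1 * p1 - (h * w1 + 0 * p1)) with (u1 - p1 - w1 * h) by ring.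
      replace (1 * u2 + -1 * p2 - (h * w2 + 0 * p2)) with (u2 - p2 - w2 * h) by ring.
      lra.
    - replace (h * w0 + 0 * p0 - (1 * u0 + -1 * p0)) with (- (u0 - p0 - w0 * h)) by ring.
      replace (h * w1 + 0 * p1 - (1 * u1 + -1 * p1)) with (- (u1 - p1 - w1 * h)) by ring.
      replace (h * w2 + 0 * p2 - (1 * u2 + -1 * p2)) with (- (u2 - p2 - w2 * h)) by ring.
      rewrite !Rabs_Ropp. lra. }
  rewrite <- Hk, Hb in Hab. pose proof (sqrt_pos (2 - 2 * dot (U (s + h)) p)) as Hk0. fold k in Hk0.
  rewrite HUs, Hp, (acos_chord (dot (U (s + h)) p)) by easy. fold k. rewrite acos_1.
  specialize (Hda2 (k / 2)). rewrite Rplus_0_l, asin_0, (Rabs_right (k / 2)) in Hda2 by lra.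
  assert (Hkh : k <= (nrm w + 1 / 3) * h) by nra.
  specialize (Hda2 ltac:(nra)). apply Rabs_le_between in Hda2.
  apply Rabs_le_between. nra.
Qed.

Lemma dist_right_derive (U : R -> vec) (s : R) (w p : vec) :
  0 <= s -> (forall r, 0 <= r -> dot (U r) (U r) = 1) -> vderive U s w ->
  dot p p = 1 ->
  exists l, right_derive (fun r => acos (dot (U r) p)) s l /\ dist_rate (U s) w p l.
Proof.
  intros Hs HU Hd Hp.
  pose proof (dot_unit_bounds _ _ (HU s Hs) Hp) as Hb.
  destruct (Rlt_dec (dot (U s) p * dot (U s) p) 1) as [H1|H1].
  - exists (- dot w p / sqrt (1 - dot (U s) p * dot (U s) p)); split; [|now left].
    apply is_derive_right.
    replace (- dot w p / sqrt (1 - dot (U s) p * dot (U s) p)) with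
      (scal (dot w p) (- / sqrt (1 - Rsqr (dot (U s) p)))).
    + apply (is_derive_comp acos (fun r => dot (U r) p)); [|apply Hd].
      apply is_derive_Reals. replace (- / sqrt (1 - Rsqr (dot (U s) p))) with
        (-1 / sqrt (1 - Rsqr (dot (U s) p))) by (unfold Rdiv; ring).
      assert (H0 : -1 < dot (U s) p < 1) by nra.
      apply (derive_pt_eq_1 _ _ _ (derivable_pt_acos _ H0)), derive_pt_acos.
    + unfold scal; simpl; unfold mult; simpl; unfold Rsqr, Rdiv; ring.
  - assert (H2 : dot (U s) p * dot (U s) p = 1) by nra.
    assert (H3 : dot (U s) p = 1 \/ dot (U s) p = -1).
    { assert ((dot (U s) p - 1) * (dot (U s) p + 1) = 0) by lra.
      apply Rmult_integral in H; lra. }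
    destruct H3 as [H3|H3].
    + exists (nrm w); split; [|right; split; [easy|now left]].
      now apply dist_right_derive_hit.
    + exists (- nrm w); split; [|right; split; [easy|now right]].
      (* [comb (-1) p 0 p] is [- p]. The distances to [p] and to [- p] add up to [PI], so the case
         of a hit applies with the opposite sign. *)
      assert (Hop : forall u, dot u (comb (-1) p 0 p) = - dot u p) by (intros u; vec; ring).
      pose proof (dist_right_derive_hit U s w (comb (-1) p 0 p) Hs HU Hd) as H.
      rewrite !Hop, dot_sym, Hop, Hp, H3 in H. specialize (H ltac:(ring) ltac:(ring)).
      apply (right_derive_scal (-1)) in H.
      intros eta He. destruct (H eta He) as [d [Hd1 Hd2]]. exists d; split; [easy|].
      intros h Hh; specialize (Hd2 h Hh). rewrite !Hop, !acos_opp in Hd2.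
      replace (acos (dot (U (s + h)) p) - acos (dot (U s) p) - - nrm w * h) with
       (-1 * (PI - acos (dot (U (s + h)) p)) - -1 * (PI - acos (dot (U s) p)) - -1 * nrm w * h)
       by ring. easy.
Qed.

(** Half the derivative of the constant [dot (U r) (U r)]. The length is known to be 1 for
    nonnegative [r] only, so at 0 the argument rests on the right derivative. *)
Lemma unit_derive_orthogonal (U : R -> vec) (s : R) (w : vec) :
  0 <= s -> (forall r, 0 <= r -> dot (U r) (U r) = 1) -> vderive U s w -> dot (U s) w = 0.
Proof.
  intros Hs HU Hd.
  assert (HD : is_derive (fun r => dot (U r) (U r)) s (2 * dot (U s) w)).
  { apply (is_derive_ext (fun r => dot (U r) (1, 0, 0) * dot (U r) (1, 0, 0) +
      (dot (U r) (0, 1, 0) * dot (U r) (0, 1, 0) + dot (U r) (0, 0, 1) * dot (U r) (0, 0, 1)))).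
    - intros r; set (u := U r); clearbody u; vec; ring.
    - evar_last.
      + apply (is_derive_plus (V := R_NormedModule)); [|apply (is_derive_plus (V := R_NormedModule))];
          apply (is_derive_mult (K := R_AbsRing)); try apply Hd; intros; apply Rmult_comm.
      + unfold plus, mult; simpl. set (u := U s); clearbody u; vec; ring. }
  apply is_derive_right in HD.
  destruct (Req_dec (dot (U s) w) 0) as [H|H]; [easy|exfalso].
  destruct (HD (Rabs (dot (U s) w))) as [d [Hd1 Hd2]]; [now apply Rabs_pos_lt|].
  specialize (Hd2 (d / 2) ltac:(lra)). rewrite !HU in Hd2 by lra.
  replace (1 - 1 - 2 * dot (U s) w * (d / 2)) with (- (d * dot (U s) w)) in Hd2 by field.
  rewrite Rabs_Ropp, Rabs_mult, (Rabs_right d) in Hd2 by lra.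
  apply Rabs_pos_lt in H. nra.
Qed.

(** The signs [eps] of the increments over all of [[a, b]] are frozen. The sum of absolute values is
    then the increment of the single function [F], and [F] minus four times the length has a
    nonpositive right derivative. *)
Lemma dist_increments_le (m : nat) (p : nat -> vec) (lam kap : nat -> R) (U W : R -> vec)
    (a b : R) :
  cone_chain m p lam kap ->
  (forall r, 0 <= r -> dot (U r) (U r) = 1) ->
  (forall s, 0 <= s -> vderive U s (W s)) ->
  (forall s, 0 <= s -> continuous (fun r => nrm (W r)) s) ->
  0 <= a <= b ->
  psum m (fun j => Rabs ((acos (dot (U b) (p (S j))) - acos (dot (U b) (p j)))
                         - (acos (dot (U a) (p (S j))) - acos (dot (U a) (p j)))))
   <= 4 * RInt (fun r => nrm (W r)) a b.
Proof.
  intros Hp HU HW HC Hab.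
  set (D := fun j r => acos (dot (U r) (p j))).
  set (eps := fun j => if Rle_dec 0 ((D (S j) b - D j b) - (D (S j) a - D j a)) then 1 else -1).
  set (F := fun r => psum m (fun j => eps j * (D (S j) r - D j r))).
  (* The velocity is continuous on the nonnegative half-line only; clamping the argument gives an
     integrand with a two-sided derivative of its integral, also at 0. *)
  set (g := fun r => nrm (W (Rmax 0 r))).
  assert (Hg : forall r, continuous g r).
  { intros r. apply (continuous_comp (Rmax 0) (fun r => nrm (W r))); [apply continuous_Rmax_0|].
    apply HC, Rmax_l. }
  set (G := fun r => RInt g a r).
  assert (HGb : RInt (fun r => nrm (W r)) a b = G b).
  { apply RInt_ext; intros x; rewrite Rmin_left by lra; intros Hx.
    unfold g; rewrite Rmax_right by lra; easy. }
  rewrite HGb.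
  assert (HeF : psum m (fun j => Rabs ((D (S j) b - D j b) - (D (S j) a - D j a))) = F b - F a).
  { replace (F b - F a) with (F b + -1 * F a) by ring. unfold F.
    rewrite <- psum_scal, <- psum_plus. apply psum_ext; intros j _; unfold eps.
    destruct (Rle_dec 0 _) as [H|H]; [rewrite Rabs_right|rewrite Rabs_left]; lra. }
  fold (D 0%nat) in *. change (psum m (fun j => Rabs ((D (S j) b - D j b) - (D (S j) a - D j a)))
    <= 4 * G b). rewrite HeF.
  assert (HG : forall s, a <= s <= b -> is_derive G s (nrm (W s))).
  { intros s Hs. replace (nrm (W s)) with (g s) by (unfold g; rewrite Rmax_right by lra; easy).
    apply (is_derive_RInt g G a s); [|apply Hg].
    exists (mkposreal 1 Rlt_0_1); intros r _. apply (RInt_correct (V := R_CompleteNormedModule)).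
    apply (ex_RInt_continuous (V := R_CompleteNormedModule)); intros; apply Hg. }
  assert (HGa : G a = 0) by (unfold G; now rewrite RInt_point).
  assert (Hmain : F b + -4 * G b <= F a + -4 * G a); [|lra].
  apply (right_derive_nonpos_decr (fun r => F r + -4 * G r)); [lra| |].
  - intros s Hs. apply continuity_pt_plus.
    + unfold F. assert (HD : forall j, (j <= m)%nat -> continuity_pt (D j) s).
      { intros j Hj. destruct Hp as [_ Hp]; destruct (Hp j Hj) as [_ [Hpj _]].
        apply (continuity_pt_comp (fun r => dot (U r) (p j)) acos).
        - apply continuity_pt_filterlim. apply (ex_derive_continuous (V := R_NormedModule)).
          exists (dot (W s) (p j)). apply HW; lra.
        - apply continuity_pt_acos, dot_unit_bounds; [apply HU; lra|easy]. }
      assert (HP : forall k, (k <= m)%nat ->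
        continuity_pt (fun r => psum k (fun j => eps j * (D (S j) r - D j r))) s).
      { induction k as [|k IH]; intros Hk; [apply continuity_pt_const; easy|].
        simpl. apply continuity_pt_plus; [apply IH; lia|].
        apply continuity_pt_mult; [apply continuity_pt_const; easy|].
        apply continuity_pt_minus; apply HD; lia. }
      now apply HP.
    + apply continuity_pt_mult; [apply continuity_pt_const; easy|].
      apply continuity_pt_filterlim, (ex_derive_continuous (V := R_NormedModule)).
      exists (nrm (W s)); now apply HG.
  - intros s Hs.
    assert (exists l : nat -> R, forall j, (j <= m)%nat ->
      right_derive (D j) s (l j) /\ dist_rate (U s) (W s) (p j) (l j)) as [l Hl].
    { apply (functional_choice (fun j lj => (j <= m)%nat ->
        right_derive (D j) s lj /\ dist_rate (U s) (W s) (p j) lj)).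
      intros j. destruct (Compare_dec.le_dec j m) as [Hj|Hj]; [|exists 0; easy].
      destruct (dist_right_derive U s (W s) (p j)) as [lj H]; try easy; try lra.
      - apply HW; lra.
      - now apply Hp.
      - now exists lj. }
    exists (psum m (fun j => eps j * (l (S j) - l j)) + -4 * nrm (W s)); split.
    + assert (Hd0 : dot (U s) (W s) = 0) by (apply (unit_derive_orthogonal U); [lra|easy|apply HW; lra]).
      pose proof (dist_rate_variation m p lam kap (U s) (W s) l eps Hp (HU s ltac:(lra)) Hd0
        (fun j Hj => proj2 (Hl j Hj))) as HV.
      assert (He : forall j, Rabs (eps j) <= 1).
      { intros j; unfold eps; destruct (Rle_dec 0 _); [rewrite Rabs_R1; lra|].
        rewrite Rabs_left; lra. }
      specialize (HV He). lra.
    + apply right_derive_plus.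
      * apply right_derive_psum; intros j Hj. apply right_derive_scal.
        apply (right_derive_ext (fun r => D (S j) r + -1 * D j r)); [intros; ring|].
        replace (l (S j) - l j) with (l (S j) + -1 * l j) by ring.
        apply right_derive_plus; [apply Hl; lia|apply right_derive_scal, Hl; lia].
      * apply right_derive_scal, is_derive_right, HG; lra.
Qed.

(** * Zeros of the factored operator *)

Lemma is_derive_nonneg_right (f : R -> R) (s l d : R) :
  is_derive f s l -> f s = 0 -> 0 < d -> (forall r, s < r < s + d -> 0 <= f r) -> 0 <= l.
Proof.
  intros Hf Hs Hd Hr. apply Rnot_lt_le; intros Hl.
  destruct (is_derive_eps f s l Hf (- l / 2)) as [e [He1 He2]]; [lra|].
  set (h := Rmin (d / 2) (e / 2)).
  assert (Hh : 0 < h /\ h <= d / 2 /\ h <= e / 2).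
  { unfold h; split; [apply Rmin_pos; lra|split; [apply Rmin_l|apply Rmin_r]]. }
  specialize (He2 h); rewrite (Rabs_right h) in He2 by lra. specialize (He2 ltac:(lra)).
  specialize (Hr (s + h) ltac:(lra)). apply Rabs_le_between in He2. nra.
Qed.

(** Reversing argument and value together leaves the derivative its sign, which turns first sign
    changes into last ones. *)
Lemma is_derive_reflect (f : R -> R) (s l : R) :
  is_derive f (- s) l -> is_derive (fun r => - f (- r)) s l.
Proof.
  intros H. evar_last.
  - apply (is_derive_opp (fun r => f (- r))).
    apply (is_derive_comp f Ropp); [apply H|].
    apply (is_derive_opp (fun r : R => r)), @is_derive_id.
  - unfold opp, scal, one; simpl; unfold mult; simpl. ring.
Qed.

(** The point is the end of the longest initial interval on which [f] is nonnegative: a positive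
    value or a positive derivative there would let the interval continue. *)
Lemma first_sign_change (f df : R -> R) (a c : R) :
  (forall s, is_derive f s (df s)) -> a < c -> 0 <= f a -> f c < 0 ->
  exists x, a <= x < c /\ f x = 0 /\ df x <= 0 /\ forall s, a <= s <= x -> 0 <= f s.
Proof.
  intros Hf Hac Ha Hc.
  set (P := fun x => a <= x <= c /\ forall s, a <= s <= x -> 0 <= f s).
  destruct (completeness P) as [x [Hx1 Hx2]].
  { exists c; intros y [Hy _]; lra. }
  { exists a; split; [lra|]. intros s Hs; now replace s with a by lra. }
  assert (Hax : a <= x <= c).
  { split; [apply Hx1; split; [lra|intros s Hs; now replace s with a by lra]
           |apply Hx2; intros y [Hy _]; lra]. }
  assert (Hlow : forall s, a <= s < x -> 0 <= f s).
  { intros s Hs; apply Rnot_lt_le; intros Hn. assert (x <= s); [|lra].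
    apply Hx2; intros y [Hy1 Hy2]; apply Rnot_lt_le; intros Hn2. specialize (Hy2 s); lra. }
  (* Maximality of [x] in reusable form: nonnegativity cannot persist on any interval to the right
     of [x]. *)
  assert (Hext : forall d, 0 < d -> 0 <= f x -> (forall h, 0 < h < d -> 0 <= f (x + h)) -> x < c -> False).
  { intros d Hd Hfx Hh Hxc.
    set (e := Rmin (d / 2) (c - x)).
    assert (He : 0 < e /\ e <= d / 2 /\ e <= c - x).
    { unfold e; split; [apply Rmin_pos; lra|split; [apply Rmin_l|apply Rmin_r]]. }
    assert (x + e <= x); [|lra]. apply Hx1; split; [lra|]. intros s Hs.
    destruct (Rlt_dec s x); [apply Hlow; lra|].
    destruct (Req_dec s x) as [->|]; [easy|]. replace s with (x + (s - x)) by ring. apply Hh; lra. }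
  assert (Hfx : 0 <= f x).
  { destruct (Req_dec a x) as [<-|Hne]; [easy|]. apply Rnot_lt_le; intros Hn.
    destruct (is_derive_eps f x _ (Hf x) 1 Rlt_0_1) as [e [He1 He2]].
    set (k := Rabs (df x) + 1). assert (Hk : 1 <= k) by (unfold k; pose proof (Rabs_pos (df x)); lra).
    set (h := Rmin (Rmin (e / 2) (x - a)) (- f x / (2 * k))).
    assert (Hq : 0 < - f x / (2 * k)) by (apply Rdiv_lt_0_compat; lra).
    assert (Hh : 0 < h /\ h <= e / 2 /\ h <= x - a /\ h * k <= - f x / 2).
    { unfold h. pose proof (Rmin_l (Rmin (e / 2) (x - a)) (- f x / (2 * k))).
      pose proof (Rmin_r (Rmin (e / 2) (x - a)) (- f x / (2 * k))).
      pose proof (Rmin_l (e / 2) (x - a)). pose proof (Rmin_r (e / 2) (x - a)).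
      repeat split; try lra; [repeat apply Rmin_pos; lra|].
      apply Rle_trans with (- f x / (2 * k) * k); [apply Rmult_le_compat_r; lra|right; field; lra]. }
    specialize (He2 (- h)). rewrite Rabs_Ropp, (Rabs_right h) in He2 by lra.
    specialize (He2 ltac:(lra)). specialize (Hlow (x + - h) ltac:(lra)).
    apply Rabs_le_between in He2.
    assert (Rabs (df x) * h >= df x * h) by (pose proof (Rle_abs (df x)); nra).
    assert (Rabs (df x) * h >= - df x * h) by (pose proof (Rle_abs (- df x)); rewrite Rabs_Ropp in *; nra).
    unfold k in *; nra. }
  assert (Hxc : x < c) by (destruct (Req_dec x c) as [->|]; lra).
  exists x; split; [lra|]; split; [|split].
  - apply Rle_antisym; [|easy]. apply Rnot_lt_le; intros Hn.
    destruct (is_derive_eps f x _ (Hf x) 1 Rlt_0_1) as [e [He1 He2]].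
    set (k := Rabs (df x) + 1). assert (Hk : 1 <= k) by (unfold k; pose proof (Rabs_pos (df x)); lra).
    apply (Hext (Rmin e (f x / k))); [|easy| |easy].
    { apply Rmin_pos; [easy|apply Rdiv_lt_0_compat; lra]. }
    intros h Hh. pose proof (Rmin_l e (f x / k)). pose proof (Rmin_r e (f x / k)).
    assert (Hhk : h * k <= f x).
    { apply Rle_trans with (f x / k * k); [apply Rmult_le_compat_r; lra|right; field; lra]. }
    specialize (He2 h). rewrite (Rabs_right h) in He2 by lra. specialize (He2 ltac:(lra)).
    apply Rabs_le_between in He2.
    assert (Rabs (df x) * h >= - df x * h) by (pose proof (Rle_abs (- df x)); rewrite Rabs_Ropp in *; nra).
    unfold k in *; nra.
  - apply Rnot_lt_le; intros Hn.
    destruct (is_derive_eps f x _ (Hf x) (df x / 2)) as [e [He1 He2]]; [lra|].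
    apply (Hext e He1 Hfx); [|easy]. intros h Hh.
    specialize (He2 h). rewrite (Rabs_right h) in He2 by lra. specialize (He2 ltac:(lra)).
    apply Rabs_le_between in He2. nra.
  - intros s Hs. destruct (Req_dec s x) as [->|]; [easy|]. apply Hlow; lra.
Qed.

Lemma last_sign_change (f df : R -> R) (c b : R) :
  (forall s, is_derive f s (df s)) -> c < b -> f b <= 0 -> 0 < f c ->
  exists x, c < x <= b /\ f x = 0 /\ df x <= 0 /\ forall s, x <= s <= b -> f s <= 0.
Proof.
  intros Hf Hcb Hb Hc.
  destruct (first_sign_change (fun r => - f (- r)) (fun r => df (- r)) (- b) (- c)) as [x [H1 [H0 [H2 H3]]]].
  - intros s; apply is_derive_reflect, Hf.
  - lra.
  - rewrite Ropp_involutive; lra.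
  - rewrite Ropp_involutive; lra.
  - exists (- x); split; [lra|]; split; [lra|]; split; [easy|]. intros s Hs.
    specialize (H3 (- s) ltac:(lra)). rewrite Ropp_involutive in H3; lra.
Qed.

(** Stated on the whole line, although the equation lives on a half-line, so that two-sided
    derivatives are available at a zero located at 0. *)
Definition jet (Y0 Y1 Y2 Y3 : R -> R) : Prop :=
  (forall s, is_derive Y0 s (Y1 s)) /\ (forall s, is_derive Y1 s (Y2 s)) /\
  (forall s, is_derive Y2 s (Y3 s)).

Lemma jet_scal g Y0 Y1 Y2 Y3 : jet Y0 Y1 Y2 Y3 ->
  jet (fun s => g * Y0 s) (fun s => g * Y1 s) (fun s => g * Y2 s) (fun s => g * Y3 s).
Proof.
  intros [H0 [H1 H2]]; split; [|split]; intros s;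
    apply (is_derive_scal); easy.
Qed.

Lemma jet_factor_derive Y0 Y1 Y2 Y3 l s : jet Y0 Y1 Y2 Y3 ->
  is_derive (fun s => Y1 s - l * Y0 s) s (Y2 s - l * Y1 s).
Proof.
  intros [H0 [H1 H2]]. apply (is_derive_minus (V := R_NormedModule)); [easy|].
  apply (is_derive_scal); easy.
Qed.

(** The integrating factor turns the mean value theorem into a Rolle theorem for [D - l]. *)
Lemma jet_exp_derive Y0 Y1 Y2 Y3 l s : jet Y0 Y1 Y2 Y3 ->
  is_derive (fun s => Y0 s * exp (- l * s)) s (exp (- l * s) * (Y1 s - l * Y0 s)).
Proof.
  intros [H0 _]. evar_last.
  - apply (is_derive_mult (K := R_AbsRing)); [apply H0| |intros; apply Rmult_comm].
    apply (is_derive_comp exp (fun s => - l * s)); [apply is_derive_exp|].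
    apply (is_derive_scal), @is_derive_id.
  - unfold plus, mult, scal, one; simpl; unfold mult; simpl. ring.
Qed.

Lemma MVT_is_derive (f df : R -> R) a b : a < b -> (forall s, is_derive f s (df s)) ->
  exists c, a < c < b /\ f b - f a = df c * (b - a).
Proof.
  intros Hab Hf.
  destruct (MVT_cor2 f df a b Hab) as [c [H1 H2]].
  - intros s _; apply is_derive_Reals, Hf.
  - now exists c.
Qed.

(** [fac2 l l'] is [(D - l) (D - l')] applied to the function with jet [Y0, Y1, Y2]. *)
Definition fac2 (l l' : R) (Y0 Y1 Y2 : R -> R) (s : R) : R :=
  Y2 s - (l + l') * Y1 s + l * l' * Y0 s.

(** [(D - l') Y0] is nonnegative at [s0] and negative somewhere later; [a] is its first downward
    crossing. Symmetrically [b] is the last downward crossing of [(D - l) Y0]. As [Y0] is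
    nonnegative and [l < l'], the sign of one factor on each outer piece entails that of the
    other. *)
Lemma positive_gap (Y0 Y1 Y2 Y3 : R -> R) (l l' s0 s1 : R) :
  jet Y0 Y1 Y2 Y3 -> l < l' -> s0 < s1 -> Y0 s0 = 0 -> Y0 s1 = 0 ->
  (forall s, s0 < s < s1 -> 0 < Y0 s) ->
  exists a b, s0 <= a /\ a < b /\ b <= s1 /\
    fac2 l l' Y0 Y1 Y2 a <= 0 /\ fac2 l l' Y0 Y1 Y2 b <= 0 /\
    (forall s, s0 <= s <= a -> 0 <= Y1 s - l * Y0 s /\ 0 <= Y1 s - l' * Y0 s) /\
    (forall s, b <= s <= s1 -> Y1 s - l * Y0 s <= 0 /\ Y1 s - l' * Y0 s <= 0).
Proof.
  intros HY Hll Hs Hs0 Hs1 Hpos.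
  pose proof HY as [H0 [H1 H2]].
  set (c := (s0 + s1) / 2). assert (Hc : 0 < Y0 c) by (apply Hpos; unfold c; lra).
  assert (Hd0 : 0 <= Y1 s0).
  { apply (is_derive_nonneg_right Y0 s0 _ (s1 - s0)); [easy|easy|lra|].
    intros r Hr; left; apply Hpos; lra. }
  assert (Hd1 : Y1 s1 <= 0).
  { assert (0 <= - Y1 s1); [|lra].
    apply (is_derive_nonneg_right (fun r => Y0 (- r)) (- s1) _ (s1 - s0)).
    - apply (is_derive_ext (fun r => - (- Y0 (- r)))); [intros r; apply Ropp_involutive|].
      apply (is_derive_opp (fun r => - Y0 (- r))).
      apply is_derive_reflect. rewrite Ropp_involutive; apply H0.
    - now rewrite Ropp_involutive.
    - lra.
    - intros r Hr; left; apply Hpos; lra. }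
  (* [exp (- l' s) * Y0 s] falls from a positive value at the midpoint to 0 at [s1]. *)
  assert (HA : exists x, c < x < s1 /\ Y1 x - l' * Y0 x < 0).
  { destruct (MVT_is_derive _ _ c s1 ltac:(unfold c; lra)
      (fun s => jet_exp_derive Y0 Y1 Y2 Y3 l' s HY)) as [x [Hx1 Hx2]].
    exists x; split; [easy|]. rewrite Hs1 in Hx2.
    pose proof (exp_pos (- l' * x)). pose proof (exp_pos (- l' * c)).
    apply Rnot_le_lt; intros Hn.
    assert (0 <= exp (- l' * x) * (Y1 x - l' * Y0 x)) by nra. nra. }
  assert (HB : exists x, s0 < x < c /\ 0 < Y1 x - l * Y0 x).
  { destruct (MVT_is_derive _ _ s0 c ltac:(unfold c; lra)
      (fun s => jet_exp_derive Y0 Y1 Y2 Y3 l s HY)) as [x [Hx1 Hx2]].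
    exists x; split; [easy|]. rewrite Hs0 in Hx2.
    pose proof (exp_pos (- l * x)). pose proof (exp_pos (- l * c)).
    apply Rnot_le_lt; intros Hn.
    assert (exp (- l * x) * (Y1 x - l * Y0 x) <= 0) by nra. nra. }
  destruct HA as [xa [Hxa1 Hxa2]], HB as [xb [Hxb1 Hxb2]]. unfold c in *.
  destruct (first_sign_change _ _ s0 xa (fun s => jet_factor_derive Y0 Y1 Y2 Y3 l' s HY))
    as [a [Ha1 [Ha0 [Ha2 Ha3]]]]; [lra|rewrite Hs0; lra|easy|].
  destruct (last_sign_change _ _ xb s1 (fun s => jet_factor_derive Y0 Y1 Y2 Y3 l s HY))
    as [b [Hb1 [Hb0 [Hb2 Hb3]]]]; [lra|rewrite Hs1; lra|easy|].
  assert (Hnn : forall s, s0 <= s <= s1 -> 0 <= Y0 s).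
  { intros s Hs'. destruct (Req_dec s s0) as [->|]; [lra|].
    destruct (Req_dec s s1) as [->|]; [lra|]. left; apply Hpos; lra. }
  assert (HpA : forall s, s0 <= s <= a -> 0 <= Y1 s - l * Y0 s /\ 0 <= Y1 s - l' * Y0 s).
  { intros s Hs'. specialize (Ha3 s Hs'). specialize (Hnn s ltac:(lra)). split; nra. }
  assert (HpB : forall s, b <= s <= s1 -> Y1 s - l * Y0 s <= 0 /\ Y1 s - l' * Y0 s <= 0).
  { intros s Hs'. specialize (Hb3 s Hs'). specialize (Hnn s ltac:(lra)). split; nra. }
  (* If [b <= a], both sign conditions would hold at [a], giving [(l' - l) * Y0 a <= 0] at an
     interior point of the gap. *)
  assert (Hab : a < b).
  { apply Rnot_le_lt; intros Hn. specialize (Hb3 a ltac:(lra)). specialize (Ha3 a ltac:(lra)).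
    specialize (Hpos a ltac:(lra)). nra. }
  (* [fac2] is the derivative of one first-order factor minus a multiple of that factor. At a zero
     of the factor only the derivative is left, and a downward crossing makes it nonpositive. *)
  assert (HZa : fac2 l l' Y0 Y1 Y2 a = (Y2 a - l' * Y1 a) - l * (Y1 a - l' * Y0 a))
    by (unfold fac2; ring).
  assert (HZb : fac2 l l' Y0 Y1 Y2 b = (Y2 b - l * Y1 b) - l' * (Y1 b - l * Y0 b))
    by (unfold fac2; ring).
  rewrite Ha0 in HZa. rewrite Hb0 in HZb.
  exists a, b. split; [lra|]. split; [easy|]. split; [lra|]. split; [lra|]. split; [lra|].
  now split.
Qed.

Lemma signed_gap (Y0 Y1 Y2 Y3 : R -> R) (g l l' s0 s1 : R) :
  jet Y0 Y1 Y2 Y3 -> l < l' -> s0 < s1 -> Y0 s0 = 0 -> Y0 s1 = 0 ->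
  (forall s, s0 < s < s1 -> 0 < g * Y0 s) ->
  exists a b, s0 <= a /\ a < b /\ b <= s1 /\
    g * fac2 l l' Y0 Y1 Y2 a <= 0 /\ g * fac2 l l' Y0 Y1 Y2 b <= 0 /\
    (forall s, s0 <= s <= a -> 0 <= g * (Y1 s - l * Y0 s) /\ 0 <= g * (Y1 s - l' * Y0 s)) /\
    (forall s, b <= s <= s1 -> g * (Y1 s - l * Y0 s) <= 0 /\ g * (Y1 s - l' * Y0 s) <= 0).
Proof.
  intros HY Hll Hs Hs0 Hs1 Hpos.
  destruct (positive_gap _ _ _ _ l l' s0 s1 (jet_scal g _ _ _ _ HY)) as
    [a [b [H1 [H2 [H3 [H4 [H5 [H6 H7]]]]]]]]; try easy.
  - rewrite Hs0; ring.
  - rewrite Hs1; ring.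
  - unfold fac2 in *. exists a, b; split; [easy|]. split; [easy|]. split; [easy|].
    split; [lra|]. split; [lra|].
    split; intros s Hs'; [specialize (H6 s Hs')|specialize (H7 s Hs')]; split; lra.
Qed.

Lemma fac2_continuity l l' Y0 Y1 Y2 Y3 g : jet Y0 Y1 Y2 Y3 ->
  continuity (fun s => g * fac2 l l' Y0 Y1 Y2 s).
Proof.
  intros [H0 [H1 H2]] s. unfold fac2. apply continuity_pt_filterlim.
  apply (ex_derive_continuous (V := R_NormedModule)
    (fun s => g * (Y2 s - (l + l') * Y1 s + l * l' * Y0 s))).
  exists (g * (Y3 s - (l + l') * Y2 s + l * l' * Y1 s)).
  apply (is_derive_scal).
  apply (is_derive_plus (V := R_NormedModule)); [|apply (is_derive_scal); easy].
  apply (is_derive_minus (V := R_NormedModule)); [easy|apply (is_derive_scal); easy].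
Qed.

Lemma IVT_le (f : R -> R) a b : continuity f -> a <= b ->
  (f a <= 0 /\ 0 <= f b) \/ (0 <= f a /\ f b <= 0) -> exists c, a <= c <= b /\ f c = 0.
Proof.
  intros Hf Hab H. destruct (IVT_cor f a b Hf Hab) as [c Hc]; [nra|now exists c].
Qed.

(** If [Y0] changes sign at [tk], then [fac2] has opposite weak signs at [b] and [a], and one zero
    serves as both [q] and [p]. If it keeps its sign, [tk] is a multiple zero where [g * fac2] is
    nonnegative, so there is a zero on each side. The point [q] carries the signs of the end of the
    left gap, [p] those of the beginning of the right one. *)
Lemma signs_around_zero (Y0 Y1 Y2 Y3 : R -> R) (g g' l l' b tk a s' : R) :
  jet Y0 Y1 Y2 Y3 -> (g = 1 \/ g = -1) -> (g' = 1 \/ g' = -1) ->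
  b <= tk -> tk <= a -> Y0 tk = 0 ->
  tk < s' -> (forall s, tk < s < s' -> 0 < g' * Y0 s) ->
  g * fac2 l l' Y0 Y1 Y2 b <= 0 -> g' * fac2 l l' Y0 Y1 Y2 a <= 0 ->
  (forall s, b <= s <= tk -> g * (Y1 s - l * Y0 s) <= 0 /\ g * (Y1 s - l' * Y0 s) <= 0) ->
  (forall s, tk <= s <= a -> 0 <= g' * (Y1 s - l * Y0 s) /\ 0 <= g' * (Y1 s - l' * Y0 s)) ->
  exists q p, b <= q /\ q <= p /\ p <= a /\
    fac2 l l' Y0 Y1 Y2 q = 0 /\ fac2 l l' Y0 Y1 Y2 p = 0 /\
    g * (Y1 q - l * Y0 q) <= 0 /\ g * (Y1 q - l' * Y0 q) <= 0 /\
    0 <= g' * (Y1 p - l * Y0 p) /\ 0 <= g' * (Y1 p - l' * Y0 p).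
Proof.
  intros HY Hg Hg' Hb Ha H0 Hs' Hpos Hzb Hza HL HR.
  assert (Hcase : g' = - g \/ g' = g) by (destruct Hg, Hg'; subst; lra).
  assert (Hgn : forall x, g * x = 0 -> x = 0) by (intros x; destruct Hg; subst; lra).
  destruct Hcase as [->| ->].
  - destruct (IVT_le _ b a (fac2_continuity l l' _ _ _ _ g HY)) as [c [Hc1 Hc2]]; [lra|lra|].
    apply Hgn in Hc2. exists c, c.
    assert (g * (Y1 c - l * Y0 c) <= 0 /\ g * (Y1 c - l' * Y0 c) <= 0).
    { destruct (Rle_dec c tk); [apply HL; lra|]. specialize (HR c ltac:(lra)). lra. }
    repeat split; try lra; easy.
  - assert (Y1k : Y1 tk = 0).
    { apply Hgn. specialize (HL tk ltac:(lra)). specialize (HR tk ltac:(lra)).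
      rewrite H0 in *. lra. }
    (* At [tk] the operator reduces to [Y2 tk], and a negative [g * Y2 tk] would make [g * Y0]
       negative just after the double zero. *)
    assert (Hz : 0 <= g * fac2 l l' Y0 Y1 Y2 tk).
    { unfold fac2; rewrite H0, Y1k.
      replace (g * (Y2 tk - (l + l') * 0 + l * l' * 0)) with (g * Y2 tk) by ring.
      apply Rnot_lt_le; intros Hn.
      destruct (jet_scal g _ _ _ _ HY) as [J0 [J1 _]].
      destruct (is_derive_eps _ _ _ (J1 tk) (- (g * Y2 tk) / 2)) as [e [He1 He2]]; [lra|].
      set (h := Rmin (e / 2) ((s' - tk) / 2)).
      assert (Hh : 0 < h /\ h <= e / 2 /\ h <= (s' - tk) / 2).
      { unfold h; split; [apply Rmin_pos; lra|split; [apply Rmin_l|apply Rmin_r]]. }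
      destruct (MVT_is_derive _ _ tk (tk + h) ltac:(lra) J0) as [x [Hx1 Hx2]].
      specialize (Hpos (tk + h) ltac:(lra)).
      specialize (He2 (x - tk)). rewrite (Rabs_right (x - tk)) in He2 by lra.
      specialize (He2 ltac:(lra)). replace (tk + (x - tk)) with x in He2 by ring.
      rewrite Y1k in He2. rewrite H0 in Hx2. apply Rabs_le_between in He2.
      assert (g * Y1 x < 0) by nra. nra. }
    destruct (IVT_le _ b tk (fac2_continuity l l' _ _ _ _ g HY)) as [q [Hq1 Hq2]]; [lra|lra|].
    destruct (IVT_le _ tk a (fac2_continuity l l' _ _ _ _ g HY)) as [p [Hp1 Hp2]]; [lra|lra|].
    apply Hgn in Hq2, Hp2. exists q, p.
    specialize (HL q ltac:(lra)). specialize (HR p ltac:(lra)).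
    repeat split; try lra; easy.
Qed.

(** Each gap strictly inside the list of zeros makes [E] swing from [-d] to [d] or back. *)
Lemma zero_chain_variation (Y0 Y1 Y2 Y3 : R -> R) (l l' d : R) (E : R -> R) (n : nat) (T g : nat -> R) :
  jet Y0 Y1 Y2 Y3 -> l < l' -> 0 <= T 0%nat -> (3 <= n)%nat ->
  (forall i, (S i < n)%nat -> T i < T (S i)) -> (forall i, (i < n)%nat -> Y0 (T i) = 0) ->
  (forall i, (S i < n)%nat -> (g i = 1 \/ g i = -1) /\
     forall s, T i < s < T (S i) -> 0 < g i * Y0 s) ->
  (forall s, 0 <= s -> fac2 l l' Y0 Y1 Y2 s = 0 ->
     (0 <= Y1 s - l * Y0 s -> 0 <= Y1 s - l' * Y0 s -> E s = - d) /\
     (Y1 s - l * Y0 s <= 0 -> Y1 s - l' * Y0 s <= 0 -> E s = d)) ->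
  exists L, StronglySorted Rle L /\ (forall x, In x L -> 0 <= x <= T (n - 1)%nat) /\
    INR (n - 3) * (2 * d) <= variation E L.
Proof.
  intros HY Hll HT0 Hn HT HTz Hg HE.
  assert (exists AB : nat -> R * R, forall i, (S i < n)%nat ->
    let a := fst (AB i) in let b := snd (AB i) in
    T i <= a /\ a < b /\ b <= T (S i) /\
    g i * fac2 l l' Y0 Y1 Y2 a <= 0 /\ g i * fac2 l l' Y0 Y1 Y2 b <= 0 /\
    (forall s, T i <= s <= a -> 0 <= g i * (Y1 s - l * Y0 s) /\ 0 <= g i * (Y1 s - l' * Y0 s)) /\
    (forall s, b <= s <= T (S i) -> g i * (Y1 s - l * Y0 s) <= 0 /\ g i * (Y1 s - l' * Y0 s) <= 0))
    as [AB HAB].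
  { apply (functional_choice (fun i ab => (S i < n)%nat ->
      let a := fst ab in let b := snd ab in
      T i <= a /\ a < b /\ b <= T (S i) /\
      g i * fac2 l l' Y0 Y1 Y2 a <= 0 /\ g i * fac2 l l' Y0 Y1 Y2 b <= 0 /\
      (forall s, T i <= s <= a -> 0 <= g i * (Y1 s - l * Y0 s) /\ 0 <= g i * (Y1 s - l' * Y0 s)) /\
      (forall s, b <= s <= T (S i) -> g i * (Y1 s - l * Y0 s) <= 0 /\ g i * (Y1 s - l' * Y0 s) <= 0))).
    intros i. destruct (Compare_dec.lt_dec (S i) n) as [Hi|Hi]; [|exists (0, 0); easy].
    destruct (signed_gap Y0 Y1 Y2 Y3 (g i) l l' (T i) (T (S i))) as [a [b H]]; try easy.
    - now apply HT.
    - apply HTz; lia.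
    - now apply HTz.
    - now apply Hg.
    - now exists (a, b). }
  (* The pair of index [i] surrounds the zero [T (S i)], so the indices run over the [n - 2] zeros
     that have a gap on either side. *)
  assert (exists QP : nat -> R * R, forall i, (S (S i) < n)%nat ->
    let q := fst (QP i) in let p := snd (QP i) in
    snd (AB i) <= q /\ q <= p /\ p <= fst (AB (S i)) /\
    E q = g i * d /\ E p = - (g (S i) * d)) as [QP HQP].
  { apply (functional_choice (fun i qp => (S (S i) < n)%nat ->
      let q := fst qp in let p := snd qp in
      snd (AB i) <= q /\ q <= p /\ p <= fst (AB (S i)) /\
      E q = g i * d /\ E p = - (g (S i) * d))).
    intros i. destruct (Compare_dec.lt_dec (S (S i)) n) as [Hi|Hi]; [|exists (0, 0); easy].
    destruct (HAB i ltac:(lia)) as [B1 [B2 [B3 [B4 [B5 [B6 B7]]]]]].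
    destruct (HAB (S i) ltac:(lia)) as [C1 [C2 [C3 [C4 [C5 [C6 C7]]]]]].
    destruct (Hg i ltac:(lia)) as [G1 G2]. destruct (Hg (S i) ltac:(lia)) as [G3 G4].
    destruct (signs_around_zero Y0 Y1 Y2 Y3 (g i) (g (S i)) l l' (snd (AB i)) (T (S i))
      (fst (AB (S i))) (T (S (S i)))) as [q [p [H1 [H2 [H3 [H4 [H5 [H6 [H7 [H8 H9]]]]]]]]]]; try easy.
    - apply HTz; lia.
    - now apply HT.
    - exists (q, p); intros _; simpl. repeat split; try easy.
      + assert (0 <= q).
        { assert (0 <= T i); [|lra]. clear - HT0 HT Hi.
          induction i as [|i IH]; [easy|]. specialize (IH ltac:(lia)). specialize (HT i ltac:(lia)). lra. }
        destruct (HE q H H4) as [E1 E2]. destruct G1 as [G1|G1]; rewrite G1 in *.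
        * rewrite E2; lra.
        * rewrite E1; lra.
      + assert (0 <= p).
        { assert (0 <= T i); [|lra]. clear - HT0 HT Hi.
          induction i as [|i IH]; [easy|]. specialize (IH ltac:(lia)). specialize (HT i ltac:(lia)). lra. }
        destruct (HE p H H5) as [E1 E2]. destruct G3 as [G3|G3]; rewrite G3 in *.
        * rewrite E1; lra.
        * rewrite E2; lra. }
  set (q := fun i => fst (QP i)). set (p := fun i => snd (QP i)).
  (* The swing over gap [S k] runs from [p k] to [q (S k)], where [E] is [- g (S k) * d] and
     [g (S k) * d]. With [r] counting the remaining swings, [k] starts at 0 and there are [n - 3] of
     them. *)
  assert (Hchain : forall r k, (k + r + 3 = n)%nat -> exists L, StronglySorted Rle L /\
    (forall x, In x L -> p k <= x <= T (n - 1)%nat) /\ INR r * (2 * d) <= variation E L).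
  { induction r as [|r IH]; intros k Hk.
    - exists nil; split; [constructor|]; split; [easy|]. simpl; lra.
    - destruct (IH (S k) ltac:(lia)) as [L [L1 [L2 L3]]].
      destruct (HQP k ltac:(lia)) as [Q1 [Q2 [Q3 [Q4 Q5]]]].
      destruct (HQP (S k) ltac:(lia)) as [R1 [R2 [R3 [R4 R5]]]].
      destruct (HAB (S k) ltac:(lia)) as [_ [B2 [B3 _]]].
      destruct (HAB (S (S k)) ltac:(lia)) as [C1 [C2 [C3 _]]].
      fold (q k) (p k) (q (S k)) (p (S k)) in *.
      assert (HTn : T (S (S (S k))) <= T (n - 1)%nat).
      { assert (Hm : forall j, (S (S (S k)) + j < n)%nat -> T (S (S (S k))) <= T (S (S (S k)) + j)%nat).
        { induction j as [|j IHj]; intros Hj; [rewrite Nat.add_0_r; lra|].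
          specialize (IHj ltac:(lia)). rewrite Nat.add_succ_r.
          specialize (HT (S (S (S k)) + j)%nat ltac:(lia)). lra. }
        specialize (Hm (n - 1 - S (S (S k)))%nat ltac:(lia)).
        now replace (S (S (S k)) + (n - 1 - S (S (S k))))%nat with (n - 1)%nat in Hm by lia. }
      exists (p k :: q (S k) :: L). split; [|split].
      + constructor; [constructor; [easy|]|constructor; [lra|]]; apply Forall_forall;
          intros x Hx; specialize (L2 x Hx); lra.
      + intros x [<-|[<-|Hx]]; [lra|lra|]. specialize (L2 x Hx); lra.
      + rewrite variation_cons, S_INR.
        pose proof (variation_cons_ge E (q (S k)) L). rewrite Q5, R4.
        destruct (Hg (S k) ltac:(lia)) as [G1 _].
        assert (2 * d <= Rabs (g (S k) * d - - (g (S k) * d))).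
        { destruct G1 as [->| ->].
          - eapply Rle_trans; [|apply Rle_abs]; lra.
          - rewrite <- Rabs_Ropp. eapply Rle_trans; [|apply Rle_abs]; lra. }
        lra. }
  destruct (Hchain (n - 3)%nat 0%nat ltac:(lia)) as [L [L1 [L2 L3]]].
  exists L; split; [easy|]; split; [|easy].
  intros x Hx; specialize (L2 x Hx). split; [|lra].
  destruct (HQP 0%nat ltac:(lia)) as [Q1 [Q2 _]]. destruct (HAB 0%nat ltac:(lia)) as [B1 [B2 _]].
  unfold p in L2; lra.
Qed.

(** * Length of the boundary of the cone *)

(** [u] lies on the great circle of [p] and [q], on the arc from [q] to [- p]. The geodesic from [p]
    to [u] passes through [q], and the triangle inequality is an equality. *)
Lemma acos_difference_plane (p q : vec) (a b : R) :
  dot p p = 1 -> dot q q = 1 -> dot p q * dot p q < 1 -> 0 <= a -> 0 <= b ->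
  let u := comb (- a) p b q in dot u u = 1 ->
  acos (dot u q) - acos (dot u p) = - acos (dot p q).
Proof.
  intros Hp Hq Hc Ha Hb u Hu.
  assert (Hup : dot u p = b * dot p q - a).
  { unfold u; rewrite dot_comb_l, Hp, (dot_sym q p); ring. }
  assert (Huq : dot u q = b - a * dot p q).
  { unfold u; rewrite dot_comb_l, Hq; ring. }
  assert (Huu : a * a + b * b - 2 * a * b * dot p q = 1).
  { rewrite <- Hu. unfold u at 1; rewrite dot_comb_l, (dot_sym p u), (dot_sym q u), Hup, Huq; ring. }
  pose proof (dot_unit_bounds u p Hu Hp) as Bp.
  rewrite Hup in *. rewrite Huq.
  set (c := dot p q) in *. clearbody c. clear Huq Hup. clearbody u. clear Hu u Hp Hq p q.
  set (d := acos c). set (psi := acos (b * c - a)).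
  assert (Hcd : cos d = c) by (apply cos_acos; nra).
  assert (Hcp : cos psi = b * c - a) by (apply cos_acos; lra).
  pose proof (acos_bound c) as Bd. fold d in Bd.
  pose proof (acos_bound (b * c - a)) as Bpsi. fold psi in Bpsi.
  assert (Hsd : sin d * sin d = 1 - c * c).
  { pose proof (sin2_cos2 d) as H; unfold Rsqr in H. rewrite Hcd in H. lra. }
  assert (Hsd0 : 0 < sin d).
  { destruct (Rle_lt_or_eq_dec 0 (sin d)) as [H|H]; [apply sin_ge_0; lra|easy|].
    rewrite <- H in Hsd. lra. }
  assert (Hsp : sin psi = b * sin d).
  { assert (Hs0 : 0 <= sin psi) by (apply sin_ge_0; lra).
    pose proof (sin2_cos2 psi) as H; unfold Rsqr in H. rewrite Hcp in H.
    apply Rsqr_inj; [easy|nra|]. unfold Rsqr.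
    replace (b * sin d * (b * sin d)) with (b * b * (sin d * sin d)) by ring. rewrite Hsd. lra. }
  (* The order of the two angles follows from [sin (psi - d) = a * sin d], which is nonnegative; it
     is where the hypothesis on [a] enters. *)
  assert (Hge : d <= psi).
  { apply Rnot_lt_le; intros Hn.
    assert (HdPI : d <> PI) by (intros Hd; rewrite Hd, sin_PI in Hsd0; lra).
    assert (H : 0 < sin (d - psi)) by (apply sin_gt_0; lra).
    rewrite sin_minus, Hsp, Hcp, Hcd in H.
    assert (0 <= a * sin d) by (apply Rmult_le_pos; lra). lra. }
  replace (b - a * c) with (cos (psi - d)).
  - rewrite acos_cos by lra. ring.
  - rewrite cos_minus, Hcp, Hcd, Hsp.
    replace (b * sin d * sin d) with (b * (sin d * sin d)) by ring. rewrite Hsd. ring.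
Qed.

Lemma acos_difference_plane_opp (p q : vec) (a b : R) :
  dot p p = 1 -> dot q q = 1 -> dot p q * dot p q < 1 -> 0 <= a -> 0 <= b ->
  let u := comb a p (- b) q in dot u u = 1 ->
  acos (dot u q) - acos (dot u p) = acos (dot p q).
Proof.
  intros Hp Hq Hc Ha Hb u Hu.
  pose proof (acos_difference_plane p q a b Hp Hq Hc Ha Hb) as H.
  assert (Hop : forall r, dot (comb (- a) p b q) r = - dot u r).
  { intros r; unfold u; rewrite !dot_comb_l; ring. }
  simpl in H. rewrite !Hop, !acos_opp, dot_sym, Hop, Hu in H. specialize (H ltac:(ring)). lra.
Qed.

(** This is [cos t ^ 2] times [(1, tan t, tan t ^ 2)]: the boundary rays of the cone with slope
    [tan t], extended continuously to the ray of [(0, 0, 1)] at both ends [PI / 2] and [- PI / 2],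
    where the curve closes. *)
Definition cone_raw (t : R) : vec := (cos t * cos t, sin t * cos t, sin t * sin t).
Definition cone_pt (t : R) : vec := comb (/ nrm (cone_raw t)) (cone_raw t) 0 (cone_raw t).

(** Speed of [cone_pt]. *)
Definition cone_speed (t : R) : R := 4 * (sqrt (5 - cos (4 * t)) / (7 + cos (4 * t))).

Lemma sin_cos_sqr t : sin t * sin t + cos t * cos t = 1.
Proof. pose proof (sin2_cos2 t) as H; unfold Rsqr in H; easy. Qed.

Lemma cone_raw_dot t : dot (cone_raw t) (cone_raw t) = 1 - sin t * sin t * (cos t * cos t).
Proof.
  pose proof (sin_cos_sqr t). unfold cone_raw, dot.
  replace (1 - sin t * sin t * (cos t * cos t)) with
   ((sin t * sin t + cos t * cos t) * (sin t * sin t + cos t * cos t) - sin t * sin t * (cos t * cos t))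
   by (rewrite H; ring). ring.
Qed.

Lemma cone_raw_nrm t : / 2 <= nrm (cone_raw t) <= 1.
Proof.
  pose proof (nrm_sqr (cone_raw t)) as H. pose proof (nrm_pos (cone_raw t)).
  rewrite cone_raw_dot in H. pose proof (sin_cos_sqr t).
  set (x := sin t * sin t) in *. set (y := cos t * cos t) in *.
  assert (0 <= x) by (unfold x; nra). assert (0 <= y) by (unfold y; nra).
  split; nra.
Qed.

Lemma cone_pt_dot t t' :
  dot (cone_pt t) (cone_pt t') =
  dot (cone_raw t) (cone_raw t') / (nrm (cone_raw t) * nrm (cone_raw t')).
Proof.
  unfold cone_pt. pose proof (cone_raw_nrm t). pose proof (cone_raw_nrm t').
  rewrite dot_comb_l, (dot_sym (cone_raw t)), dot_comb_l, (dot_sym (cone_raw t')).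
  field; lra.
Qed.

Lemma cone_pt_unit t : dot (cone_pt t) (cone_pt t) = 1.
Proof.
  rewrite cone_pt_dot, <- nrm_sqr. pose proof (cone_raw_nrm t). field; lra.
Qed.

Lemma sin_lipschitz a b : Rabs (sin a - sin b) <= Rabs (a - b).
Proof.
  destruct (MVT_gen sin b a cos) as [c [_ Hc]].
  - intros x _; apply is_derive_sin.
  - intros x _; apply continuity_sin.
  - rewrite Hc, Rabs_mult. rewrite <- (Rmult_1_l (Rabs (a - b))) at 2.
    apply Rmult_le_compat_r; [apply Rabs_pos|]. apply Rabs_le, COS_bound.
Qed.

Lemma cos_lipschitz a b : Rabs (cos a - cos b) <= Rabs (a - b).
Proof.
  rewrite <- !sin_shift. eapply Rle_trans; [apply sin_lipschitz|].
  rewrite <- Rabs_Ropp. right; f_equal; ring.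
Qed.

Lemma sin_ge_minus_sqr h : 0 <= h -> h - h * h <= sin h.
Proof.
  intros Hh. destruct (Req_dec h 0) as [->|Hn]; [rewrite sin_0; lra|].
  destruct (MVT_cor2 sin cos 0 h ltac:(lra)) as [c [H1 H2]].
  - intros c _; apply derivable_pt_lim_sin.
  - rewrite sin_0 in H1. pose proof (cos_lipschitz c 0) as H. rewrite cos_0 in H.
    replace (c - 0) with c in H by ring. rewrite (Rabs_right c) in H by lra.
    apply Rabs_le_between in H. nra.
Qed.

(** [cone_raw t x cone_raw t' = sin (t' - t) * cone_chord t t'] *)
Definition cone_chord (t t' : R) : vec :=
  (sin t * sin t', - (sin t * cos t' + cos t * sin t'), cos t * cos t').

(** The speed of [c / |c|] is [|c x c'| / |c|^2], and letting [t'] tend to [t] identifies [c x c']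
    with the diagonal value of [cone_chord]. In terms of [4 * t] this becomes the integrand of
    [L_Omega]. *)
Lemma cone_speed_chord t :
  cone_speed t = nrm (cone_chord t t) / (nrm (cone_raw t) * nrm (cone_raw t)).
Proof.
  rewrite nrm_sqr, cone_raw_dot. unfold cone_speed.
  assert (Hx : cos (4 * t) = 1 - 8 * (sin t * sin t * (cos t * cos t))).
  { replace (4 * t) with (2 * (2 * t)) by ring. rewrite cos_2a_sin, sin_2a. ring. }
  pose proof (sin_cos_sqr t) as Hsc.
  assert (HN : nrm (cone_chord t t) = sqrt (5 - cos (4 * t)) / 2).
  { unfold nrm. replace (dot (cone_chord t t) (cone_chord t t)) with ((5 - cos (4 * t)) / (2 * 2)).
    - rewrite sqrt_div_alt by lra. rewrite sqrt_square by lra. easy.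
    - rewrite Hx. unfold cone_chord, dot.
      (* The identity holds only modulo [sin^2 + cos^2 = 1]; making the constant homogeneous of
         degree four leaves a polynomial identity. *)
      replace 5 with (1 + 4 * ((sin t * sin t + cos t * cos t) * (sin t * sin t + cos t * cos t)))
        by (rewrite Hsc; ring).
      replace (1 + 4 * ((sin t * sin t + cos t * cos t) * (sin t * sin t + cos t * cos t)) -
        (1 - 8 * (sin t * sin t * (cos t * cos t)))) with
       (4 * ((sin t * sin t + cos t * cos t) * (sin t * sin t + cos t * cos t)) +
          8 * (sin t * sin t * (cos t * cos t))) by ring. field. }
  rewrite HN, Hx. set (y := sin t * sin t * (cos t * cos t)) in *.
  assert (y <= 1 / 4).
  { unfold y. pose proof (Rle_0_sqr (sin t * sin t - cos t * cos t)) as H0; unfold Rsqr in H0.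
    assert (H1 : (sin t * sin t + cos t * cos t) * (sin t * sin t + cos t * cos t) = 1)
      by (rewrite Hsc; ring). lra. }
  field; lra.
Qed.

Lemma cone_chord_nrm t t' : nrm (cone_chord t t') <= 2.
Proof.
  pose proof (nrm_pos (cone_chord t t')). pose proof (nrm_sqr (cone_chord t t')).
  pose proof (sin_cos_sqr t) as Ht. pose proof (sin_cos_sqr t') as Ht'.
  assert (dot (cone_chord t t') (cone_chord t t') <= 4); [|nra].
  unfold cone_chord, dot.
  set (s := sin t) in *; set (c := cos t) in *; set (s' := sin t') in *; set (c' := cos t') in *.
  assert (Hone : (s * s + c * c) * (s' * s' + c' * c') = 1) by (rewrite Ht, Ht'; ring).
  pose proof (Rle_0_sqr (c * c' - s * s')). pose proof (Rle_0_sqr (s * c')).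
  pose proof (Rle_0_sqr (c * s')). unfold Rsqr in *. lra.
Qed.

Lemma cone_speed_bounds t : 0 <= cone_speed t <= 8.
Proof.
  rewrite cone_speed_chord. pose proof (cone_raw_nrm t). pose proof (cone_chord_nrm t t).
  pose proof (nrm_pos (cone_chord t t)).
  assert (He : / 4 <= nrm (cone_raw t) * nrm (cone_raw t)).
  { replace (/ 4) with (/ 2 * / 2) by field. apply Rmult_le_compat; lra. }
  split.
  - apply Rdiv_le_0_compat; lra.
  - apply Rle_div_l; lra.
Qed.

(** The sine of the distance [d] is exactly [sin h * K] with [K = N / (e * e')], the length of a
    cross product of unit vectors, and [d >= sin d]. It remains to compare [K] with the speed at
    [x]. The constant 2600 is 2592 from that comparison plus 8 from [sin h >= h - h^2] and
    [K <= 8]. *)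
Lemma cone_dist_lower (t h x : R) : 0 <= h <= 1 -> t <= x <= t + h ->
  h * cone_speed x <= acos (dot (cone_pt t) (cone_pt (t + h))) + 2600 * (h * h).
Proof.
  intros Hh Hx.
  set (t' := t + h) in *. assert (Ht' : t' = t + h) by reflexivity.
  set (N := nrm (cone_chord t t')). set (Nx := nrm (cone_chord x x)).
  set (e := nrm (cone_raw t)). set (e' := nrm (cone_raw t')). set (ex := nrm (cone_raw x)).
  pose proof (cone_raw_nrm t) as He. pose proof (cone_raw_nrm t') as He'.
  pose proof (cone_raw_nrm x) as Hex. fold e in He; fold e' in He'; fold ex in Hex.
  pose proof (cone_chord_nrm t t') as HN. fold N in HN. pose proof (nrm_pos (cone_chord t t')) as HN0. fold N in HN0.
  assert (HLip : forall u v, Rabs (u - v) <= h -> Rabs (sin u - sin v) <= h /\ Rabs (cos u - cos v) <= h).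
  { intros u v Huv. pose proof (sin_lipschitz u v). pose proof (cos_lipschitz u v). split; lra. }
  assert (Hxt : Rabs (x - t) <= h) by (apply Rabs_le; lra).
  assert (Hxt' : Rabs (x - t') <= h) by (apply Rabs_le; lra).
  destruct (HLip x t Hxt) as [S1 C1]. destruct (HLip x t' Hxt') as [S2 C2].
  assert (M : forall a b, Rabs a <= 1 -> Rabs b <= h -> Rabs (a * b) <= h).
  { intros a b Ha Hb; rewrite Rabs_mult. pose proof (Rabs_pos a). pose proof (Rabs_pos b). nra. }
  assert (Bs : forall u, Rabs (sin u) <= 1) by (intros; apply Rabs_le, SIN_bound).
  assert (Bc : forall u, Rabs (cos u) <= 1) by (intros; apply Rabs_le, COS_bound).
  assert (HNx : Nx <= N + 8 * h).
  { apply nrm_lipschitz; cbv beta iota delta [cone_chord].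
    replace (sin x * sin x - sin t * sin t') with
      (sin x * (sin x - sin t') + sin t' * (sin x - sin t)) by ring.
    replace (- (sin x * cos x + cos x * sin x) - - (sin t * cos t' + cos t * sin t')) with
      (- (sin x * (cos x - cos t') + cos t' * (sin x - sin t) +
          (cos x * (sin x - sin t') + sin t' * (cos x - cos t)))) by ring.
    replace (cos x * cos x - cos t * cos t') with
      (cos x * (cos x - cos t') + cos t' * (cos x - cos t)) by ring.
    rewrite Rabs_Ropp.
    pose proof (Rabs_triang (sin x * (sin x - sin t')) (sin t' * (sin x - sin t))).
    pose proof (Rabs_triang (cos x * (cos x - cos t')) (cos t' * (cos x - cos t))).
    pose proof (Rabs_triang (sin x * (cos x - cos t') + cos t' * (sin x - sin t))
      (cos x * (sin x - sin t') + sin t' * (cos x - cos t))).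
    pose proof (Rabs_triang (sin x * (cos x - cos t')) (cos t' * (sin x - sin t))).
    pose proof (Rabs_triang (cos x * (sin x - sin t')) (sin t' * (cos x - cos t))).
    pose proof (M _ _ (Bs x) S2). pose proof (M _ _ (Bs t') S1).
    pose proof (M _ _ (Bc x) C2). pose proof (M _ _ (Bc t') C1).
    pose proof (M _ _ (Bs x) C2). pose proof (M _ _ (Bc t') S1).
    pose proof (M _ _ (Bc x) S2). pose proof (M _ _ (Bs t') C1). lra. }
  assert (Hraw : forall u, Rabs (sin x - sin u) <= h -> Rabs (cos x - cos u) <= h ->
    nrm (cone_raw u) <= ex + 6 * h).
  { intros u Hs Hc. apply nrm_lipschitz; cbv beta iota delta [cone_raw].
    replace (cos u * cos u - cos x * cos x) with
      (- (cos x * (cos x - cos u) + cos u * (cos x - cos u))) by ring.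
    replace (sin u * cos u - sin x * cos x) with
      (- (sin x * (cos x - cos u) + cos u * (sin x - sin u))) by ring.
    replace (sin u * sin u - sin x * sin x) with
      (- (sin x * (sin x - sin u) + sin u * (sin x - sin u))) by ring.
    rewrite !Rabs_Ropp.
    pose proof (Rabs_triang (cos x * (cos x - cos u)) (cos u * (cos x - cos u))).
    pose proof (Rabs_triang (sin x * (cos x - cos u)) (cos u * (sin x - sin u))).
    pose proof (Rabs_triang (sin x * (sin x - sin u)) (sin u * (sin x - sin u))).
    pose proof (M _ _ (Bc x) Hc). pose proof (M _ _ (Bc u) Hc).
    pose proof (M _ _ (Bs x) Hc). pose proof (M _ _ (Bc u) Hs).
    pose proof (M _ _ (Bs x) Hs). pose proof (M _ _ (Bs u) Hs). lra. }
  pose proof (Hraw t S1 C1) as R1. pose proof (Hraw t' S2 C2) as R2. fold e in R1. fold e' in R2.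
  set (K := N / (e * e')).
  assert (HK : K * (e * e') = N) by (unfold K; field; lra).
  assert (Hee : / 4 <= e * e') by (replace (/ 4) with (/ 2 * / 2) by field; apply Rmult_le_compat; lra).
  assert (Hee2 : e * e' <= ex * ex + 80 * h).
  { apply Rle_trans with ((ex + 6 * h) * (ex + 6 * h)); [apply Rmult_le_compat; lra|nra]. }
  assert (HK0 : 0 <= K <= 8).
  { unfold K; split; [apply Rdiv_le_0_compat; lra|]. apply Rle_div_l; lra. }
  (* [Nx <= N + 8 h] and [N <= K ex^2 + 8 * 80 h] give an error of [648 h], and division by
     [ex^2 >= 1 / 4] makes it [2592 h]. *)
  assert (Hsp : cone_speed x <= K + 2592 * h).
  { rewrite cone_speed_chord. fold Nx ex. apply Rle_div_l; [nra|].
    assert (N <= K * (ex * ex) + 640 * h) by nra.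
    assert (/ 4 <= ex * ex) by (replace (/ 4) with (/ 2 * / 2) by field; apply Rmult_le_compat; lra). nra. }
  assert (Hd : sin h * K <= acos (dot (cone_pt t) (cone_pt t'))).
  { pose proof (dot_unit_bounds _ _ (cone_pt_unit t) (cone_pt_unit t')) as Hb.
    set (d := acos (dot (cone_pt t) (cone_pt t'))).
    pose proof (acos_bound (dot (cone_pt t) (cone_pt t'))) as Hd. fold d in Hd.
    assert (Hsd : sin h * K = sin d).
    { unfold d; rewrite sin_acos by easy.
      assert (Hs0 : 0 <= sin h) by (apply sin_ge_0; pose proof PI2_1; lra).
      rewrite <- (sqrt_Rsqr (sin h * K)) by nra. f_equal. unfold Rsqr.
      assert (HX : dot (cone_raw t) (cone_raw t') * dot (cone_raw t) (cone_raw t') =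
        (e * e) * (e' * e') - sin h * sin h * (N * N)).
      { unfold e, e', N; rewrite !nrm_sqr.
        replace (sin h) with (sin t' * cos t - cos t' * sin t)
          by (rewrite <- sin_minus; f_equal; unfold t'; ring).
        unfold cone_raw, cone_chord, dot; ring. }
      rewrite cone_pt_dot. fold e e'.
      replace (dot (cone_raw t) (cone_raw t') / (e * e') * (dot (cone_raw t) (cone_raw t') / (e * e')))
        with (dot (cone_raw t) (cone_raw t') * dot (cone_raw t) (cone_raw t') / (e * e * (e' * e')))
        by (field; lra).
      rewrite HX. unfold K. field; lra. }
    rewrite Hsd. destruct (Req_dec d 0) as [->|Hn]; [rewrite sin_0; lra|].
    left; apply sin_lt_x; lra. }
  pose proof (sin_ge_minus_sqr h (proj1 Hh)).
  assert ((h - h * h) * K <= sin h * K) by (apply Rmult_le_compat_r; lra).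
  nra.
Qed.

Lemma continuous_L_integrand x : continuous (fun al => sqrt (5 - cos al) / (7 + cos al)) x.
Proof.
  apply continuity_pt_filterlim. pose proof (COS_bound x).
  apply continuity_pt_div; [|reg|lra].
  apply (continuity_pt_comp (fun al => 5 - cos al) sqrt); [reg|apply continuity_pt_sqrt; lra].
Qed.

(** Under [al = 4 t] the parameter interval becomes [[- 2 PI, 2 PI]], two periods of an even
    integrand, hence four copies of the integral over [[0, PI]]. *)
Lemma L_Omega_cone_speed : is_RInt cone_speed (- (PI / 2)) (PI / 2) L_Omega.
Proof.
  set (f := fun al => sqrt (5 - cos al) / (7 + cos al)).
  assert (Ef : forall a b, ex_RInt f a b).
  { intros a b; apply (ex_RInt_continuous (V := R_CompleteNormedModule)); intros; apply continuous_L_integrand. }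
  set (I := RInt f 0 PI).
  assert (I1 : is_RInt f 0 PI I) by (apply (RInt_correct (V := R_CompleteNormedModule)), Ef).
  assert (I2 : is_RInt f PI (2 * PI) I).
  { pose proof (is_RInt_comp_lin (V := R_NormedModule) (fun y => f y) (-1) (2 * PI) 0 PI).
    pose proof (RInt_correct (V := R_CompleteNormedModule) f (2 * PI) PI (Ef _ _)) as J.
    specialize (H (RInt f (2 * PI) PI)).
    replace (-1 * 0 + 2 * PI) with (2 * PI) in H by ring.
    replace (-1 * PI + 2 * PI) with PI in H by ring. specialize (H J).
    assert (Hk : is_RInt f 0 PI (opp (RInt f (2 * PI) PI))).
    { apply (is_RInt_ext (fun y => opp (scal (-1) (f (-1 * y + 2 * PI))))).
      - intros x _. unfold f. replace (cos (-1 * x + 2 * PI)) with (cos x).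
        + unfold opp, scal; simpl; unfold mult; simpl. ring.
        + replace (-1 * x + 2 * PI) with (- x + 2 * INR 1 * PI) by (simpl; ring).
          now rewrite cos_period, cos_neg.
      - now apply (is_RInt_opp (V := R_NormedModule)). }
    assert (HI : I = opp (RInt f (2 * PI) PI))
      by (apply (is_RInt_unique (V := R_CompleteNormedModule)), Hk).
    rewrite HI.
    now apply (is_RInt_swap (V := R_NormedModule)). }
  assert (I3 : is_RInt f 0 (2 * PI) (2 * I)).
  { replace (2 * I) with (plus I I) by (unfold plus; simpl; ring).
    now apply (is_RInt_Chasles (V := R_NormedModule)) with PI. }
  assert (I4 : is_RInt f (- (2 * PI)) 0 (2 * I)).
  { apply (is_RInt_ext (fun y => scal 1 (f (1 * y + 2 * PI)))).
    - intros x _. unfold f. replace (cos (1 * x + 2 * PI)) with (cos x).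
      + unfold scal; simpl; unfold mult; simpl. ring.
      + replace (1 * x + 2 * PI) with (x + 2 * INR 1 * PI) by (simpl; ring). now rewrite cos_period.
    - apply (is_RInt_comp_lin (V := R_NormedModule)).
      replace (1 * - (2 * PI) + 2 * PI) with 0 by ring. now replace (1 * 0 + 2 * PI) with (2 * PI) by ring. }
  apply (is_RInt_ext (fun y => scal 4 (f (4 * y + 0)))).
  - intros x _. unfold f, cone_speed. rewrite Rplus_0_r. reflexivity.
  - apply (is_RInt_comp_lin (V := R_NormedModule)).
    replace (4 * - (PI / 2) + 0) with (- (2 * PI)) by field.
    replace (4 * (PI / 2) + 0) with (2 * PI) by field.
    replace L_Omega with (plus (2 * I) (2 * I)) by (unfold L_Omega, I, f, plus; simpl; ring).
    now apply (is_RInt_Chasles (V := R_NormedModule)) with 0.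
Qed.

Lemma is_RInt_le_const (f : R -> R) a b l M : a <= b -> is_RInt f a b l ->
  (forall x, a < x < b -> f x <= M) -> l <= (b - a) * M.
Proof.
  intros Hab Hl HM.
  apply (is_RInt_le f (fun _ => M) a b); try easy. apply (is_RInt_const (V := R_NormedModule)).
Qed.

Lemma L_Omega_pos : 0 < L_Omega.
Proof.
  apply Rlt_le_trans with (PI * / 2); [pose proof PI_RGT_0; lra|].
  replace (PI * / 2) with ((PI / 2 - - (PI / 2)) * / 2) by field.
  apply (is_RInt_le (fun _ => / 2) cone_speed (- (PI / 2)) (PI / 2)).
  - pose proof PI_RGT_0; lra.
  - apply (is_RInt_const (V := R_NormedModule)).
  - apply L_Omega_cone_speed.
  - intros x _. unfold cone_speed. pose proof (COS_bound (4 * x)).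
    assert (1 <= sqrt (5 - cos (4 * x))) by (rewrite <- sqrt_1 at 1; apply sqrt_le_1_alt; lra).
    assert (/ 8 <= sqrt (5 - cos (4 * x)) / (7 + cos (4 * x))); [|lra].
    apply Rle_div_r; nra.
Qed.

(** A uniform grid of step [PI / n] without its two end points, because at [PI / 2] and [- PI / 2]
    the slope [tan] is infinite and the ray is not of the form [(1, l, l ^ 2)]. *)
Lemma cone_polygon_length (eta : R) : 0 < eta ->
  exists (m : nat) (b : nat -> R),
    (forall j, (j <= m)%nat -> - (PI / 2) < b j < PI / 2) /\
    (forall i j, (i < j <= m)%nat -> b i < b j) /\
    L_Omega - eta < psum m (fun j => acos (dot (cone_pt (b j)) (cone_pt (b (S j))))).
Proof.
  intros Heta. pose proof PI_RGT_0 as HPI. pose proof PI_4 as HPI4.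
  (* The two end cells cost at most [8 h] each and the inner ones [2600 h^2] each, with
     [m * h <= 4]: in all [10416 h]. The summand 4 ensures [n > 2] and [h <= 1]. *)
  destruct (INR_unbounded (10500 * PI / eta + 4)) as [n Hn].
  assert (Hn0 : 0 <= 10500 * PI / eta) by (apply Rdiv_le_0_compat; lra).
  set (h := PI / INR n).
  assert (HnR : INR n * h = PI) by (unfold h; field; lra).
  assert (Hh0 : 0 < h) by (apply Rdiv_lt_0_compat; lra).
  assert (Hh1 : h <= 1) by nra.
  assert (Hheta : 10500 * h < eta).
  { assert (10500 * PI < eta * INR n).
    { replace (10500 * PI) with (eta * (10500 * PI / eta)) by (field; lra).
      apply Rmult_lt_compat_l; lra. }
    apply Rmult_lt_reg_r with (INR n); nra. }
  assert (exists m, n = (m + 2)%nat) as [m Hm].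
  { exists (n - 2)%nat. assert (2 < n)%nat by (apply INR_lt; simpl; lra). lia. }
  set (b := fun j => - (PI / 2) + (INR j + 1) * h).
  assert (HmR : (INR m + 2) * h = PI) by (rewrite <- HnR, Hm, plus_INR; reflexivity).
  assert (Hex : forall x y, ex_RInt cone_speed x y).
  { intros x y. apply (ex_RInt_continuous (V := R_CompleteNormedModule)); intros z _.
    unfold cone_speed. apply (continuous_mult (K := R_AbsRing)); [apply continuous_const|].
    apply (continuous_comp (fun t => 4 * t) (fun al => sqrt (5 - cos al) / (7 + cos al))).
    - apply (continuous_mult (K := R_AbsRing)); [apply continuous_const|apply continuous_id].
    - apply continuous_L_integrand. }
  exists m, b. split; [|split].
  - intros j Hj. apply le_INR in Hj. pose proof (pos_INR j). unfold b; split; [nra|].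
    assert ((INR j + 1) * h <= (INR m + 1) * h) by nra. lra.
  - intros i j Hij. assert (INR i < INR j) by (apply lt_INR; lia). unfold b; nra.
  - set (D := fun j => acos (dot (cone_pt (b j)) (cone_pt (b (S j))))).
    assert (Hcell : forall k, (k <= m)%nat ->
      RInt cone_speed (b 0%nat) (b k) <= psum k D + INR k * (2600 * (h * h))).
    { induction k as [|k IH]; intros Hk.
      - rewrite RInt_point. unfold zero; simpl; lra.
      - specialize (IH ltac:(lia)).
        rewrite <- (RInt_Chasles (V := R_CompleteNormedModule) cone_speed (b 0%nat) (b k) (b (S k))) by apply Hex.
        change plus with Rplus. simpl psum; rewrite S_INR.
        set (d := D k).
        assert (Hbk : b (S k) = b k + h) by (unfold b; rewrite S_INR; ring).
        assert (RInt cone_speed (b k) (b (S k)) <= d + 2600 * (h * h)).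
        { replace (d + 2600 * (h * h)) with ((b (S k) - b k) * ((d + 2600 * (h * h)) / h))
            by (rewrite Hbk; field; lra).
          apply (is_RInt_le_const cone_speed); [lra|apply (RInt_correct (V := R_CompleteNormedModule)), Hex|].
          intros x Hx. apply (Rle_div_r _ _ h); [exact Hh0|]. unfold d, D; rewrite Hbk in *.
          rewrite Rmult_comm. apply cone_dist_lower; lra. }
        lra. }
    specialize (Hcell m (le_n m)).
    assert (HL : L_Omega = RInt cone_speed (- (PI / 2)) (b 0%nat) +
      RInt cone_speed (b 0%nat) (b m) + RInt cone_speed (b m) (PI / 2)).
    { rewrite <- (is_RInt_unique _ _ _ _ L_Omega_cone_speed).
      rewrite <- (RInt_Chasles (V := R_CompleteNormedModule) cone_speed (- (PI / 2)) (b m)) by apply Hex.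
      rewrite <- (RInt_Chasles (V := R_CompleteNormedModule) cone_speed (- (PI / 2)) (b 0%nat) (b m)) by apply Hex.
      reflexivity. }
    assert (H1 : RInt cone_speed (- (PI / 2)) (b 0%nat) <= h * 8).
    { replace h with (b 0%nat - - (PI / 2)) at 1 by (unfold b; simpl; ring).
      apply (is_RInt_le_const cone_speed); [unfold b; simpl; lra| |intros; apply cone_speed_bounds].
      apply (RInt_correct (V := R_CompleteNormedModule)), Hex. }
    assert (H2 : RInt cone_speed (b m) (PI / 2) <= h * 8).
    { replace h with (PI / 2 - b m) at 1 by (unfold b; lra).
      apply (is_RInt_le_const cone_speed); [unfold b; lra| |intros; apply cone_speed_bounds].
      apply (RInt_correct (V := R_CompleteNormedModule)), Hex. }
    assert (H3 : INR m * (2600 * (h * h)) <= 10400 * h).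
    { assert (INR m * h <= 4) by lra. nra. }
    lra.
Qed.

(** * The solution and its unit path *)

Lemma deriv_Rplus_eps (f df : R -> R) (t eps : R) : deriv_Rplus f df -> 0 <= t -> 0 < eps ->
  exists d, 0 < d /\ forall h, h <> 0 -> 0 <= t + h -> Rabs h < d ->
    Rabs ((f (t + h) - f t) / h - df t) < eps.
Proof.
  intros Hf Ht He.
  destruct (Hf t Ht (ball (df t) eps) (locally_ball (df t) (mkposreal eps He))) as [d Hd].
  exists d; split; [apply cond_pos|]. intros h H1 H2 H3.
  apply (Hd h); [|easy]. unfold ball; simpl; unfold AbsRing_ball, abs, minus, plus, opp; simpl.
  now replace (h + - 0) with h by ring.
Qed.

Lemma deriv_Rplus_extend (f df g dg : R -> R) :
  deriv_Rplus f df -> (forall s, is_derive g s (dg s)) -> g 0 = f 0 -> dg 0 = df 0 ->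
  forall s, is_derive (fun s => if Rle_dec 0 s then f s else g s) s
    (if Rle_dec 0 s then df s else dg s).
Proof.
  intros Hf Hg H0 H1 s. apply is_derive_Reals. intros eps He.
  destruct (proj1 (is_derive_Reals _ _ _) (Hg s) eps He) as [[dgs Hdgs] Hd].
  simpl in Hd. destruct (Rle_dec 0 s) as [Hs|Hs].
  - destruct (deriv_Rplus_eps f df s eps Hf Hs He) as [d [Hd1 Hd2]].
    destruct (Req_dec s 0) as [->|Hn].
    + assert (Hp : 0 < Rmin d dgs) by now apply Rmin_pos.
      exists (mkposreal _ Hp); simpl. intros h Hh1 Hh2.
      pose proof (Rmin_l d dgs). pose proof (Rmin_r d dgs).
      destruct (Rle_dec 0 (0 + h)).
      * apply Hd2; lra.
      * rewrite <- H0, <- H1. apply Hd; lra.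
    + assert (Hp : 0 < Rmin d s) by (apply Rmin_pos; lra).
      exists (mkposreal _ Hp); simpl. intros h Hh1 Hh2.
      pose proof (Rmin_l d s). pose proof (Rmin_r d s).
      assert (0 <= s + h) by (pose proof (Rle_abs (- h)); rewrite Rabs_Ropp in *; lra).
      destruct (Rle_dec 0 (s + h)); [|lra]. apply Hd2; lra.
  - assert (Hp : 0 < Rmin dgs (- s)) by (apply Rmin_pos; lra).
    exists (mkposreal _ Hp); simpl. intros h Hh1 Hh2.
    pose proof (Rmin_l dgs (- s)). pose proof (Rmin_r dgs (- s)).
    pose proof (Rle_abs h). destruct (Rle_dec 0 (s + h)); [lra|]. apply Hd; lra.
Qed.

Lemma cont_Rplus_Rmax (a : R -> R) : cont_Rplus a ->
  forall s, continuous (fun r => a (Rmax 0 r)) s.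
Proof.
  intros Ha s. apply (filterlim_comp _ _ _ (Rmax 0) a _
    (within (fun r => 0 <= r) (locally (Rmax 0 s)))).
  - intros P HP. apply (continuous_Rmax_0 s) in HP.
    unfold filtermap in *. revert HP; apply filter_imp. intros r Hr; apply Hr, Rmax_l.
  - apply Ha, Rmax_l.
Qed.

(** To the left of 0 the solution is continued by its cubic Taylor polynomial, and the coefficients
    are continued by constants. The equation is kept on the nonnegative half-line only. *)
Lemma solution_extension (a b c y : R -> R) :
  cont_Rplus a -> cont_Rplus b -> cont_Rplus c -> is_solution a b c y ->
  exists Y0 Y1 Y2 Y3 A B C : R -> R,
    jet Y0 Y1 Y2 Y3 /\ (forall s, continuous Y3 s) /\
    (forall s, continuous A s) /\ (forall s, continuous B s) /\ (forall s, continuous C s) /\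
    (forall s, 0 <= s -> Y0 s = y s) /\
    (forall s, 0 <= s -> Y3 s = - (A s * Y2 s + B s * Y1 s + C s * Y0 s)).
Proof.
  intros Ha Hb Hc [y1 [y2 [y3 [H1 [H2 [H3 H4]]]]]].
  set (ext := fun f g s => if Rle_dec 0 s then f s else g s : R).
  set (g3 := fun _ : R => y3 0). set (g2 := fun s => y2 0 + y3 0 * s).
  set (g1 := fun s => y1 0 + y2 0 * s + y3 0 * (s * s / 2)).
  set (g0 := fun s => y 0 + y1 0 * s + y2 0 * (s * s / 2) + y3 0 * (s * s * s / 6)).
  set (A := fun s => a (Rmax 0 s)). set (B := fun s => b (Rmax 0 s)). set (C := fun s => c (Rmax 0 s)).
  assert (HJ : jet (ext y g0) (ext y1 g1) (ext y2 g2) (ext y3 g3)).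
  { split; [|split]; intros s; unfold ext.
    - apply (deriv_Rplus_extend y y1 g0 g1); try easy; unfold g0, g1; [|field|field].
      intros r; auto_derive; [easy|field].
    - apply (deriv_Rplus_extend y1 y2 g1 g2); try easy; unfold g1, g2; [|field|field].
      intros r; auto_derive; [easy|field].
    - apply (deriv_Rplus_extend y2 y3 g2 g3); try easy; unfold g2, g3; [|field].
      intros r; auto_derive; [easy|field]. }
  assert (HE : forall f g s, 0 <= s -> ext f g s = f s).
  { intros f g s Hs; unfold ext; destruct (Rle_dec 0 s); easy. }
  assert (HA : forall s, continuous A s) by now apply cont_Rplus_Rmax.
  assert (HB : forall s, continuous B s) by now apply cont_Rplus_Rmax.
  assert (HC : forall s, continuous C s) by now apply cont_Rplus_Rmax.
  exists (ext y g0), (ext y1 g1), (ext y2 g2), (ext y3 g3), A, B, C.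
  split; [easy|]. split; [|split; [easy|split; [easy|split; [easy|split]]]].
  - intros s.
    (* Continuity of the third derivative is not given but follows from the equation. To the left of
       0 it is constant, so at every [r] it equals the right-hand side at [Rmax 0 r]. *)
    apply (continuous_ext (fun s => - (A s * ext y2 g2 (Rmax 0 s) + B s * ext y1 g1 (Rmax 0 s)
      + C s * ext y g0 (Rmax 0 s)))).
    + intros r. pose proof (Rmax_l 0 r) as Hr. rewrite !HE by easy. unfold A, B, C.
      specialize (H4 _ Hr).
      replace (ext y3 g3 r) with (y3 (Rmax 0 r)); [lra|].
      unfold ext, g3; destruct (Rle_dec 0 r); [now rewrite Rmax_right|].
      now rewrite Rmax_left by lra.
    + destruct HJ as [J0 [J1 J2]].
      assert (HM : forall f df : R -> R, (forall s, is_derive f s (df s)) ->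
        continuous (fun s => f (Rmax 0 s)) s).
      { intros f df Hf. apply (continuous_comp (Rmax 0) f); [apply continuous_Rmax_0|].
        apply (ex_derive_continuous (V := R_NormedModule)). eexists; apply Hf. }
      apply (continuous_opp (V := R_NormedModule)
        (fun s => A s * ext y2 g2 (Rmax 0 s) + B s * ext y1 g1 (Rmax 0 s) + C s * ext y g0 (Rmax 0 s))).
      apply (continuous_plus (V := R_NormedModule)); [apply (continuous_plus (V := R_NormedModule))|];
        apply (continuous_mult (K := R_AbsRing)); try easy; eapply HM; eassumption.
  - intros s Hs; now apply HE.
  - intros s Hs. rewrite !HE by easy. unfold A, B, C. rewrite Rmax_right by easy.
    specialize (H4 s Hs). lra.
Qed.

Lemma jet_continuous Y0 Y1 Y2 Y3 : jet Y0 Y1 Y2 Y3 ->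
  (forall s, continuous Y0 s) /\ (forall s, continuous Y1 s) /\ (forall s, continuous Y2 s).
Proof.
  intros [J0 [J1 J2]]; split; [|split]; intros s;
    apply (ex_derive_continuous (V := R_NormedModule)); eexists; auto.
Qed.

(** * Nonvanishing of the phase vector *)

Definition energy (Y0 Y1 Y2 : R -> R) (s : R) : R := Y0 s * Y0 s + Y1 s * Y1 s + Y2 s * Y2 s.
Definition power (Y0 Y1 Y2 Y3 : R -> R) (s : R) : R := Y0 s * Y1 s + Y1 s * Y2 s + Y2 s * Y3 s.

Lemma energy_derive Y0 Y1 Y2 Y3 s : jet Y0 Y1 Y2 Y3 ->
  is_derive (energy Y0 Y1 Y2) s (2 * power Y0 Y1 Y2 Y3 s).
Proof.
  intros [J0 [J1 J2]]. unfold energy, power. evar_last.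
  - apply (is_derive_plus (V := R_NormedModule)); [apply (is_derive_plus (V := R_NormedModule))|];
      apply (is_derive_mult (K := R_AbsRing)); try (intros; apply Rmult_comm); auto.
  - unfold plus, mult; simpl. ring.
Qed.

(** Gronwall's argument for uniqueness: on a compact interval the derivative of the energy is at
    most [M] times the energy in absolute value, so a zero of the energy at [s0] would propagate to
    [s1]. *)
Lemma energy_pos (Y0 Y1 Y2 Y3 A B C : R -> R) (s1 : R) :
  jet Y0 Y1 Y2 Y3 ->
  (forall s, continuous A s) -> (forall s, continuous B s) -> (forall s, continuous C s) ->
  (forall s, 0 <= s -> Y3 s = - (A s * Y2 s + B s * Y1 s + C s * Y0 s)) ->
  0 <= s1 -> Y0 s1 <> 0 -> forall s, 0 <= s -> 0 < energy Y0 Y1 Y2 s.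
Proof.
  intros HJ HA HB HC HY3 Hs1 HYs1 s0 Hs0.
  set (En := energy Y0 Y1 Y2).
  assert (Hnn : forall s, 0 <= En s) by (intros s; unfold En, energy; nra).
  assert (Hp1 : 0 < En s1) by (unfold En, energy; nra).
  destruct (Rle_lt_or_eq_dec 0 (En s0) (Hnn s0)) as [Hp|Hz]; [easy|exfalso].
  set (T := Rmax s0 s1). pose proof (Rmax_l s0 s1) as HT0. pose proof (Rmax_r s0 s1) as HT1.
  fold T in HT0, HT1.
  destruct (continuity_ab_maj (fun s => Rabs (A s) + Rabs (B s) + Rabs (C s)) 0 T) as [x [Hx _]];
    [lra| |].
  { intros c _.
    assert (HR : forall f : R -> R, (forall s, continuous f s) -> continuity_pt (fun s => Rabs (f s)) c).
    { intros f Hf. apply (continuity_pt_comp f Rabs); [apply continuity_pt_filterlim, Hf|].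
      apply Rcontinuity_abs. }
    repeat apply continuity_pt_plus; now apply HR. }
  set (K := Rabs (A x) + Rabs (B x) + Rabs (C x)) in *.
  set (M := 2 + 2 * K).
  assert (HP : forall s, 0 <= s <= T -> Rabs (2 * power Y0 Y1 Y2 Y3 s) <= M * En s).
  { intros s Hs. specialize (Hx s Hs). unfold power, En, energy. rewrite (HY3 s) by lra.
    pose proof (Rabs_pos (A s)); pose proof (Rabs_pos (B s)); pose proof (Rabs_pos (C s)).
    set (u := Y0 s); set (v := Y1 s); set (w := Y2 s). set (e := u * u + v * v + w * w).
    assert (Q : forall x z r, Rabs (2 * (x * z)) <= x * x + z * z + r * r).
    { clear; intros x z r. pose proof (Rle_0_sqr (x - z)). pose proof (Rle_0_sqr (x + z)).
      pose proof (Rle_0_sqr r). unfold Rsqr in *. apply Rabs_le; lra. }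
    assert (Huv : Rabs (2 * (u * v)) <= e) by (eapply Rle_trans; [apply (Q u v w)|unfold e; lra]).
    assert (Hvw : Rabs (2 * (v * w)) <= e) by (eapply Rle_trans; [apply (Q v w u)|unfold e; lra]).
    assert (Huw : Rabs (2 * (u * w)) <= e) by (eapply Rle_trans; [apply (Q u w v)|unfold e; lra]).
    assert (Hww : Rabs (w * w) <= e).
    { pose proof (Rle_0_sqr u). pose proof (Rle_0_sqr v). pose proof (Rle_0_sqr w).
      unfold Rsqr in *. apply Rabs_le; unfold e; lra. }
    replace (2 * (u * v + v * w + w * - (A s * w + B s * v + C s * u))) with
      (2 * (u * v) + 2 * (v * w) + - (2 * (A s * (w * w)) + B s * (2 * (v * w)) + C s * (2 * (u * w)))) by ring.
    assert (e0 : 0 <= e) by (eapply Rle_trans; [apply Rabs_pos|apply Huv]).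
    assert (T1 : Rabs (2 * (A s * (w * w))) <= 2 * (Rabs (A s) * e)).
    { rewrite Rabs_mult, (Rabs_right 2), Rabs_mult by lra.
      apply Rmult_le_compat_l; [lra|now apply Rmult_le_compat_l]. }
    assert (T2 : Rabs (B s * (2 * (v * w))) <= Rabs (B s) * e)
      by (rewrite Rabs_mult; now apply Rmult_le_compat_l).
    assert (T3 : Rabs (C s * (2 * (u * w))) <= Rabs (C s) * e)
      by (rewrite Rabs_mult; now apply Rmult_le_compat_l).
    pose proof (Rabs_triang (2 * (u * v) + 2 * (v * w))
      (- (2 * (A s * (w * w)) + B s * (2 * (v * w)) + C s * (2 * (u * w))))) as R1.
    rewrite Rabs_Ropp in R1.
    pose proof (Rabs_triang (2 * (u * v)) (2 * (v * w))).
    pose proof (Rabs_triang (2 * (A s * (w * w)) + B s * (2 * (v * w))) (C s * (2 * (u * w)))).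
    pose proof (Rabs_triang (2 * (A s * (w * w))) (B s * (2 * (v * w)))).
    unfold M. nra. }
  assert (HD : forall k s, is_derive (fun s => En s * exp (k * s)) s
     ((2 * power Y0 Y1 Y2 Y3 s + k * En s) * exp (k * s))).
  { intros k s. evar_last.
    - apply (is_derive_mult (K := R_AbsRing)); [apply (energy_derive Y0 Y1 Y2 Y3), HJ| |intros; apply Rmult_comm].
      apply (is_derive_comp exp (fun s => k * s)); [apply is_derive_exp|].
      apply is_derive_scal, @is_derive_id.
    - unfold plus, mult, scal, one; simpl; unfold mult; simpl. ring. }
  (* Forward propagation uses that the energy times [exp (- M s)] does not increase, backward
     propagation that the energy times [exp (M s)] does not decrease. *)
  destruct (Rtotal_order s0 s1) as [Hlt|[He|Hlt]].
  - destruct (MVT_is_derive _ _ s0 s1 Hlt (HD (- M))) as [c [Hc1 Hc2]].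
    rewrite <- Hz in Hc2. pose proof (exp_pos (- M * s1)). pose proof (exp_pos (- M * c)).
    specialize (HP c ltac:(lra)). apply Rabs_le_between in HP.
    assert ((2 * power Y0 Y1 Y2 Y3 c + - M * En c) * exp (- M * c) <= 0) by nra. nra.
  - rewrite He in Hz; lra.
  - destruct (MVT_is_derive _ _ s1 s0 Hlt (HD M)) as [c [Hc1 Hc2]].
    rewrite <- Hz in Hc2. pose proof (exp_pos (M * s1)). pose proof (exp_pos (M * c)).
    specialize (HP c ltac:(lra)). apply Rabs_le_between in HP.
    assert (0 <= (2 * power Y0 Y1 Y2 Y3 c + M * En c) * exp (M * c)) by nra. nra.
Qed.

(** * The path on the unit sphere and its velocity *)

Definition unit_jet (Y0 Y1 Y2 : R -> R) (s : R) : vec :=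
  let e := sqrt (energy Y0 Y1 Y2 s) in (Y0 s / e, Y1 s / e, Y2 s / e).

Definition unit_jet_velocity (Y0 Y1 Y2 Y3 : R -> R) (s : R) : vec :=
  let e := sqrt (energy Y0 Y1 Y2 s) in
  let k := power Y0 Y1 Y2 Y3 s / (e * e * e) in
  (Y1 s / e - k * Y0 s, Y2 s / e - k * Y1 s, Y3 s / e - k * Y2 s).

Lemma unit_jet_unit Y0 Y1 Y2 s : 0 < energy Y0 Y1 Y2 s ->
  dot (unit_jet Y0 Y1 Y2 s) (unit_jet Y0 Y1 Y2 s) = 1.
Proof.
  intros H. unfold unit_jet, dot. pose proof (sqrt_lt_R0 _ H) as Hs.
  set (e := sqrt (energy Y0 Y1 Y2 s)) in *.
  assert (He : e * e = Y0 s * Y0 s + Y1 s * Y1 s + Y2 s * Y2 s) by (apply sqrt_sqrt; left; exact H).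
  transitivity ((Y0 s * Y0 s + Y1 s * Y1 s + Y2 s * Y2 s) / (e * e)); [field; lra|].
  rewrite <- He; field; lra.
Qed.

Lemma is_derive_div_sqrt (f En : R -> R) (s df dE : R) :
  is_derive f s df -> is_derive En s (2 * dE) -> 0 < En s ->
  is_derive (fun r => f r / sqrt (En r)) s
    (df / sqrt (En s) - dE / (sqrt (En s) * sqrt (En s) * sqrt (En s)) * f s).
Proof.
  intros Hf HE Hp. pose proof (sqrt_lt_R0 _ Hp) as Hs.
  evar_last.
  - apply is_derive_div; [apply Hf| |lra].
    apply (is_derive_sqrt En); [apply HE|apply Hp].
  - simpl. field. lra.
Qed.

Lemma unit_jet_vderive Y0 Y1 Y2 Y3 s : jet Y0 Y1 Y2 Y3 -> 0 < energy Y0 Y1 Y2 s ->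
  vderive (unit_jet Y0 Y1 Y2) s (unit_jet_velocity Y0 Y1 Y2 Y3 s).
Proof.
  intros HJ Hp [[p0 p1] p2]. pose proof HJ as [J0 [J1 J2]].
  pose proof (energy_derive Y0 Y1 Y2 Y3 s HJ) as HE.
  unfold unit_jet, unit_jet_velocity, dot.
  pose proof (is_derive_div_sqrt _ _ s _ _ (J0 s) HE Hp) as D0.
  pose proof (is_derive_div_sqrt _ _ s _ _ (J1 s) HE Hp) as D1.
  pose proof (is_derive_div_sqrt _ _ s _ _ (J2 s) HE Hp) as D2.
  evar_last.
  - apply (is_derive_plus (V := R_NormedModule)); [apply (is_derive_plus (V := R_NormedModule))|];
      (apply (is_derive_mult (K := R_AbsRing)); [eassumption|apply @is_derive_const|intros; apply Rmult_comm]).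
  - unfold plus, mult, zero; simpl. ring.
Qed.

Lemma continuous_nrm_velocity Y0 Y1 Y2 Y3 s : jet Y0 Y1 Y2 Y3 -> continuous Y3 s ->
  0 < energy Y0 Y1 Y2 s -> continuous (fun r => nrm (unit_jet_velocity Y0 Y1 Y2 Y3 r)) s.
Proof.
  intros HJ H3 Hp. destruct (jet_continuous _ _ _ _ HJ) as [C0 [C1 C2]].
  specialize (C0 s); specialize (C1 s); specialize (C2 s).
  assert (CE : continuous (energy Y0 Y1 Y2) s).
  { apply (ex_derive_continuous (V := R_NormedModule)). eexists; now apply (energy_derive _ _ _ Y3). }
  apply continuity_pt_filterlim in H3, C0, C1, C2, CE.
  apply continuous_sqrt_comp. unfold unit_jet_velocity, dot.
  pose proof (sqrt_lt_R0 _ Hp) as Hs.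
  assert (Ce : continuity_pt (fun r => sqrt (energy Y0 Y1 Y2 r)) s).
  { apply (continuity_pt_comp (energy Y0 Y1 Y2) sqrt); [easy|apply continuity_pt_sqrt; lra]. }
  assert (Ck : continuity_pt (fun r => power Y0 Y1 Y2 Y3 r /
     (sqrt (energy Y0 Y1 Y2 r) * sqrt (energy Y0 Y1 Y2 r) * sqrt (energy Y0 Y1 Y2 r))) s).
  { apply continuity_pt_div.
    - unfold power. repeat apply continuity_pt_plus; apply continuity_pt_mult; easy.
    - repeat apply continuity_pt_mult; easy.
    - apply Rgt_not_eq; repeat apply Rmult_lt_0_compat; easy. }
  assert (Cc : forall f g, continuity_pt f s -> continuity_pt g s -> continuity_pt
     (fun r => f r / sqrt (energy Y0 Y1 Y2 r) - power Y0 Y1 Y2 Y3 r /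
     (sqrt (energy Y0 Y1 Y2 r) * sqrt (energy Y0 Y1 Y2 r) * sqrt (energy Y0 Y1 Y2 r)) * g r) s).
  { intros f g Hf Hg. apply continuity_pt_minus.
    - apply continuity_pt_div; [easy|easy|lra].
    - apply (continuity_pt_mult _ g); easy. }
  apply continuity_pt_filterlim.
  apply continuity_pt_plus; [apply continuity_pt_plus|]; apply continuity_pt_mult; apply Cc; easy.
Qed.

(** [Derive] is two-sided and [y] is unrestricted at negative arguments, so its derivatives are
    identified for positive arguments only; the end point 0 does not affect the integral. *)
Lemma gamma3_velocity y Y0 Y1 Y2 Y3 t : jet Y0 Y1 Y2 Y3 -> (forall s, 0 <= s -> Y0 s = y s) ->
  (forall s, 0 <= s -> 0 < energy Y0 Y1 Y2 s) -> 0 < t ->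
  gamma3 y t = RInt (fun r => nrm (unit_jet_velocity Y0 Y1 Y2 Y3 r)) 0 t.
Proof.
  intros HJ Hy Hp Ht. pose proof HJ as [J0 [J1 J2]].
  assert (Hloc : forall s, 0 < s -> locally s (fun r => 0 < r)).
  { intros s Hs. now apply (open_gt 0). }
  assert (D1 : forall s, 0 < s -> Derive y s = Y1 s).
  { intros s Hs. apply is_derive_unique. apply (is_derive_ext_loc Y0); [|apply J0].
    generalize (Hloc s Hs); apply filter_imp; intros r Hr; apply Hy; lra. }
  assert (D2 : forall s, 0 < s -> Derive (Derive y) s = Y2 s).
  { intros s Hs. apply is_derive_unique. apply (is_derive_ext_loc Y1); [|apply J1].
    generalize (Hloc s Hs); apply filter_imp; intros r Hr; symmetry; now apply D1. }
  assert (HN : forall s, 0 < s -> xnorm y s = sqrt (energy Y0 Y1 Y2 s)).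
  { intros s Hs. unfold xnorm, energy. rewrite D1, D2, <- Hy by lra. f_equal; ring. }
  unfold gamma3. apply RInt_ext. intros s. rewrite Rmin_left, Rmax_right by lra. intros Hs.
  pose proof (energy_derive Y0 Y1 Y2 Y3 s HJ) as HE. specialize (Hp s ltac:(lra)).
  assert (U : forall (u f : R -> R) df, is_derive f s df ->
    (forall r, 0 < r -> u r = f r / sqrt (energy Y0 Y1 Y2 r)) ->
    Derive u s = df / sqrt (energy Y0 Y1 Y2 s) - power Y0 Y1 Y2 Y3 s /
      (sqrt (energy Y0 Y1 Y2 s) * sqrt (energy Y0 Y1 Y2 s) * sqrt (energy Y0 Y1 Y2 s)) * f s).
  { intros u f df Hf Hu. apply is_derive_unique.
    apply (is_derive_ext_loc (fun r => f r / sqrt (energy Y0 Y1 Y2 r))).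
    - generalize (Hloc s ltac:(lra)); apply filter_imp; intros r Hr; symmetry; now apply Hu.
    - now apply is_derive_div_sqrt. }
  rewrite (U (unit0 y) Y0 (Y1 s)), (U (unit1 y) Y1 (Y2 s)), (U (unit2 y) Y2 (Y3 s)); auto.
  - unfold nrm, unit_jet_velocity, dot. f_equal; ring.
  - intros r Hr; unfold unit2; now rewrite HN, D2.
  - intros r Hr; unfold unit1; now rewrite HN, D1.
  - intros r Hr; unfold unit0; rewrite HN, <- Hy by lra; easy.
Qed.

(** * Zeros in increasing order *)

Lemma sorted_nth_lt (l : list R) : StronglySorted Rle l -> NoDup l ->
  forall i j, (i < j < length l)%nat -> nth i l 0 < nth j l 0.
Proof.
  induction l as [|x l IH]; intros Hs Hn i j Hij; simpl in Hij; [lia|].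
  apply StronglySorted_inv in Hs; destruct Hs as [Hs1 Hs2].
  inversion Hn as [|? ? Hx Hn']; subst.
  destruct j as [|j]; [lia|]. destruct i as [|i]; simpl.
  - assert (In (nth j l 0) l) by (apply nth_In; lia).
    rewrite Forall_forall in Hs2. specialize (Hs2 _ H).
    destruct (Req_dec x (nth j l 0)); [subst; contradiction|lra].
  - apply IH; try easy; lia.
Qed.

Lemma nu_eq_enumeration (y : R -> R) (t : R) (n : nat) : nu_eq y t n ->
  exists T : nat -> R,
    (forall i j, (i < j < n)%nat -> T i < T j) /\
    (forall i, (i < n)%nat -> 0 <= T i <= t /\ y (T i) = 0) /\
    (forall i s, (S i < n)%nat -> T i < s < T (S i) -> y s <> 0).
Proof.
  intros [l [Hl1 [Hl2 Hl3]]].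
  pose proof (isort_perm l) as HP. set (L := isort l) in *.
  assert (HL : length L = n) by (rewrite <- Hl2; symmetry; now apply Permutation_length).
  assert (Hlt : forall i j, (i < j < n)%nat -> nth i L 0 < nth j L 0).
  { rewrite <- HL. apply sorted_nth_lt; [apply isort_sorted|].
    now apply (Permutation_NoDup HP). }
  assert (Hz : forall i, (i < n)%nat -> 0 <= nth i L 0 <= t /\ y (nth i L 0) = 0).
  { intros i Hi. apply Hl3. apply (Permutation_in _ (Permutation_sym HP)), nth_In; lia. }
  exists (fun i => nth i L 0). split; [easy|]. split; [easy|].
  intros i s Hi Hs Hy.
  assert (Hin : In s L).
  { apply (Permutation_in _ HP), Hl3. pose proof (Hz i ltac:(lia)). pose proof (Hz (S i) Hi).
    split; [lra|easy]. }
  apply (In_nth _ _ 0) in Hin. destruct Hin as [k [Hk1 Hk2]]. rewrite HL in Hk1.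
  destruct (Compare_dec.le_lt_dec k i) as [Hki|Hki].
  - destruct (Nat.eq_dec k i) as [->|]; [lra|]. pose proof (Hlt k i ltac:(lia)). lra.
  - destruct (Nat.eq_dec k (S i)) as [->|]; [lra|]. pose proof (Hlt (S i) k ltac:(lia)). lra.
Qed.

Lemma constant_sign (f : R -> R) (a b : R) : continuity f -> a < b ->
  (forall s, a < s < b -> f s <> 0) ->
  exists g, (g = 1 \/ g = -1) /\ forall s, a < s < b -> 0 < g * f s.
Proof.
  intros Hf Hab Hn. set (m := (a + b) / 2). assert (Hm : a < m < b) by (unfold m; lra).
  assert (H : forall g, (g = 1 \/ g = -1) -> 0 < g * f m -> forall s, a < s < b -> 0 < g * f s).
  { intros g Hg Hgm s Hs. apply Rnot_le_lt; intros Hle.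
    destruct (Rle_dec s m) as [Hsm|Hsm].
    - destruct (IVT_cor f s m Hf Hsm) as [c [Hc1 Hc2]]; [destruct Hg; subst; nra|].
      apply (Hn c); [lra|easy].
    - destruct (IVT_cor f m s Hf) as [c [Hc1 Hc2]]; [lra|destruct Hg; subst; nra|].
      apply (Hn c); [lra|easy]. }
  specialize (Hn m Hm). destruct (Rlt_dec 0 (f m)).
  - exists 1; split; [now left|]. apply H; [now left|lra].
  - exists (-1); split; [now right|]. apply H; [now right|lra].
Qed.

(** * Boundary points and extremal distance differences *)

Lemma cone_pt_chain (m : nat) (b : nat -> R) :
  (forall j, (j <= m)%nat -> - (PI / 2) < b j < PI / 2) ->
  (forall i j, (i < j <= m)%nat -> b i < b j) ->
  cone_chain m (fun j => cone_pt (b j)) (fun j => tan (b j))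
    (fun j => cos (b j) * cos (b j) / nrm (cone_raw (b j))).
Proof.
  intros Hb Hinc. split.
  - intros i j Hij. pose proof (Hb i ltac:(lia)). pose proof (Hb j ltac:(lia)).
    apply tan_increasing; [lra|now apply Hinc|lra].
  - intros j Hj. pose proof (Hb j Hj). pose proof (cone_raw_nrm (b j)).
    assert (Hc : 0 < cos (b j)) by (apply cos_gt_0; lra).
    split; [apply Rdiv_lt_0_compat; nra|]. split; [apply cone_pt_unit|].
    unfold cone_pt, tan. set (r := nrm (cone_raw (b j))) in *. unfold comb, cone_raw.
    f_equal; [f_equal|]; field; lra.
Qed.

(** The third coordinate of the cross product is [kap i * kap j * (lam j - lam i)], so the two
    points are neither equal nor antipodal. *)
Lemma cone_chain_distinct m p lam kap i j : cone_chain m p lam kap -> (i < j <= m)%nat ->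
  dot (p i) (p j) * dot (p i) (p j) < 1.
Proof.
  intros [H1 H2] Hij. destruct (H2 i ltac:(lia)) as [Ki [Pi Ei]].
  destruct (H2 j ltac:(lia)) as [Kj [Pj Ej]]. specialize (H1 i j Hij).
  pose proof (dot_cross (p i) (p j)) as Hc. rewrite Pi, Pj in Hc.
  assert (Hpos : 0 < dot (cross (p i) (p j)) (cross (p i) (p j))); [|lra].
  rewrite Ei, Ej. unfold cross, dot.
  assert (Hk : 0 < kap i * (kap j * lam j) - kap i * lam i * kap j).
  { replace (kap i * (kap j * lam j) - kap i * lam i * kap j) with
      (kap i * kap j * (lam j - lam i)) by ring.
    repeat apply Rmult_lt_0_compat; lra. }
  apply Rplus_le_lt_0_compat; [apply Rplus_le_le_0_compat; apply Rle_0_sqr|].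
  now apply Rmult_lt_0_compat.
Qed.

(** Up to the factor [l' - l], [fac2] is the determinant of [(1, l, l ^ 2)], [(1, l', l' ^ 2)] and
    the phase vector. Once it vanishes, the coordinates in the plane of the two rays are read off
    from [Y0] and [Y1]; they are positive multiples of the two first-order factors, up to sign. *)
Lemma unit_jet_plane Y0 Y1 Y2 s l l' k k' : l < l' -> 0 < k -> 0 < k' ->
  0 < energy Y0 Y1 Y2 s -> fac2 l l' Y0 Y1 Y2 s = 0 ->
  let e := sqrt (energy Y0 Y1 Y2 s) in
  unit_jet Y0 Y1 Y2 s =
    comb (- ((Y1 s - l' * Y0 s) / ((l' - l) * e * k))) (k, k * l, k * (l * l))
         ((Y1 s - l * Y0 s) / ((l' - l) * e * k')) (k', k' * l', k' * (l' * l')).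
Proof.
  intros Hl Hk Hk' Hp Hf e. pose proof (sqrt_lt_R0 _ Hp) as He. fold e in He.
  assert (H2 : Y2 s = (l + l') * Y1 s - l * l' * Y0 s) by (unfold fac2 in Hf; lra).
  unfold unit_jet, comb. fold e. rewrite H2.
  f_equal; [f_equal|]; field; repeat split; lra.
Qed.

Lemma dist_difference_extremal Y0 Y1 Y2 s m p lam kap j :
  cone_chain m p lam kap -> (j < m)%nat -> 0 < energy Y0 Y1 Y2 s ->
  fac2 (lam j) (lam (S j)) Y0 Y1 Y2 s = 0 ->
  let D := acos (dot (unit_jet Y0 Y1 Y2 s) (p (S j))) - acos (dot (unit_jet Y0 Y1 Y2 s) (p j)) in
  (0 <= Y1 s - lam j * Y0 s -> 0 <= Y1 s - lam (S j) * Y0 s -> D = - acos (dot (p j) (p (S j)))) /\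
  (Y1 s - lam j * Y0 s <= 0 -> Y1 s - lam (S j) * Y0 s <= 0 -> D = acos (dot (p j) (p (S j)))).
Proof.
  intros Hch Hj Hp Hf D. pose proof Hch as [H1 H2].
  destruct (H2 j ltac:(lia)) as [Ki [Pi Ei]]. destruct (H2 (S j) ltac:(lia)) as [Kj [Pj Ej]].
  pose proof (H1 j (S j) ltac:(lia)) as Hl.
  pose proof (cone_chain_distinct m p lam kap j (S j) Hch ltac:(lia)) as Hd.
  pose proof (unit_jet_unit Y0 Y1 Y2 s Hp) as Hu.
  pose proof (unit_jet_plane Y0 Y1 Y2 s _ _ _ _ Hl Ki Kj Hp Hf) as HU. cbv zeta in HU.
  rewrite <- Ei, <- Ej in HU. unfold D.
  pose proof (sqrt_lt_R0 _ Hp) as He.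
  set (e := sqrt (energy Y0 Y1 Y2 s)) in *.
  assert (Hq : forall k x, 0 < k -> 0 <= x -> 0 <= x / ((lam (S j) - lam j) * e * k)).
  { intros k x Hk Hx. apply Rdiv_le_0_compat; [easy|]. repeat apply Rmult_lt_0_compat; lra. }
  split; intros A B.
  - rewrite HU in *. apply acos_difference_plane; auto.
  - set (a := - (Y1 s - lam (S j) * Y0 s) / ((lam (S j) - lam j) * e * kap j)).
    set (b := - (Y1 s - lam j * Y0 s) / ((lam (S j) - lam j) * e * kap (S j))).
    assert (HU' : unit_jet Y0 Y1 Y2 s = comb a (p j) (- b) (p (S j))).
    { rewrite HU. f_equal; unfold a, b, Rdiv; ring. }
    rewrite HU' in *. apply acos_difference_plane_opp; auto; apply Hq; lra.
Qed.

Theorem theorem1 (a b c y : R -> R) :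
  cont_Rplus a -> cont_Rplus b -> cont_Rplus c ->
  is_solution a b c y ->
  (exists s, 0 <= s /\ y s <> 0) ->
  forall (t : R) (n : nat), 0 < t -> nu_eq y t n ->
    gamma3 y t > (INR n - 5) / 2 * L_Omega.
Proof.
  intros Ha Hb Hc Hsol [s1 [Hs1 Hys1]] t n Ht Hnu.
  destruct (solution_extension a b c y Ha Hb Hc Hsol) as
    [Y0 [Y1 [Y2 [Y3 [A [B [C [HJ [H3 [HA [HB [HC [Hy HY3]]]]]]]]]]]]].
  assert (Hp : forall s, 0 <= s -> 0 < energy Y0 Y1 Y2 s).
  { apply (energy_pos Y0 Y1 Y2 Y3 A B C s1); try easy. now rewrite Hy. }
  rewrite (gamma3_velocity y Y0 Y1 Y2 Y3 t HJ Hy Hp Ht).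
  set (U := unit_jet Y0 Y1 Y2). set (W := unit_jet_velocity Y0 Y1 Y2 Y3).
  assert (HU : forall r, 0 <= r -> dot (U r) (U r) = 1) by (intros r Hr; now apply unit_jet_unit, Hp).
  assert (HW : forall s, 0 <= s -> vderive U s (W s)) by (intros r Hr; apply unit_jet_vderive; auto).
  assert (HWc : forall s, 0 <= s -> continuous (fun r => nrm (W r)) s).
  { intros r Hr; apply continuous_nrm_velocity; auto. }
  assert (Hex : forall x z, 0 <= x -> 0 <= z -> ex_RInt (fun r => nrm (W r)) x z).
  { intros x z Hx Hz. apply (ex_RInt_continuous (V := R_CompleteNormedModule)).
    intros r [Hr _]. apply HWc. apply Rle_trans with (Rmin x z); [now apply Rmin_glb|easy]. }
  pose proof L_Omega_pos as HL.
  (* Below five zeros the right-hand side is negative. Exactly five belong to the main case, where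
     strictness comes from the strict polygon estimate. *)
  destruct (Compare_dec.le_lt_dec 5 n) as [Hn|Hn].
  2: { apply Rlt_le_trans with 0.
       - assert (INR n < 5) by (replace 5 with (INR 5) by (simpl; lra); now apply lt_INR). nra.
       - apply RInt_ge_0; [lra|apply Hex; lra|intros; apply nrm_pos]. }
  assert (Hn3 : INR (n - 3) = INR n - 3) by (rewrite minus_INR by lia; simpl; lra).
  assert (Hn5 : 5 <= INR n) by (replace 5 with (INR 5) by (simpl; lra); now apply le_INR).
  (* This error is the solution [eta] of [(n - 3) * (L_Omega - eta) = (n - 5) * L_Omega]. *)
  destruct (cone_polygon_length (2 * L_Omega / (INR n - 3))) as [m [be [Hb1 [Hb2 Hb3]]]].
  { apply Rdiv_lt_0_compat; lra. }
  pose proof (cone_pt_chain m be Hb1 Hb2) as Hch.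
  set (p := fun j => cone_pt (be j)) in *. set (lam := fun j => tan (be j)) in *.
  set (kap := fun j => cos (be j) * cos (be j) / nrm (cone_raw (be j))) in *.
  destruct (nu_eq_enumeration y t n Hnu) as [T [HT1 [HT2 HT3]]].
  assert (exists g : nat -> R, forall i, (S i < n)%nat -> (g i = 1 \/ g i = -1) /\
     forall s, T i < s < T (S i) -> 0 < g i * Y0 s) as [g Hg].
  { apply (functional_choice (fun i gi => (S i < n)%nat -> (gi = 1 \/ gi = -1) /\
     forall s, T i < s < T (S i) -> 0 < gi * Y0 s)).
    intros i. destruct (Compare_dec.lt_dec (S i) n) as [Hi|Hi]; [|exists 0; easy].
    destruct (constant_sign Y0 (T i) (T (S i))) as [gi Hgi].
    - intros s. apply continuity_pt_filterlim. apply (proj1 (jet_continuous _ _ _ _ HJ)).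
    - apply HT1; lia.
    - intros s Hs. pose proof (HT2 i ltac:(lia)). rewrite Hy by lra. now apply (HT3 i).
    - now exists gi. }
  set (dj := fun j => acos (dot (p j) (p (S j)))).
  set (E := fun j s => acos (dot (U s) (p (S j))) - acos (dot (U s) (p j))).
  set (G := fun x => 4 * RInt (fun r => nrm (W r)) 0 x).
  assert (Hsum : psum m (fun j => INR (n - 3) * (2 * dj j)) <= G t - G 0).
  { apply (psum_chain_le m E G t); [|lra|].
    - intros u v Huv Hvt. unfold E.
      eapply Rle_trans; [apply (dist_increments_le m p lam kap U W u v); auto|].
      right. unfold G.
      rewrite <- (RInt_Chasles (V := R_CompleteNormedModule) (fun r => nrm (W r)) 0 u v)
        by (apply Hex; lra).
      change plus with Rplus. ring.
    - intros j Hj.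
      destruct (zero_chain_variation Y0 Y1 Y2 Y3 (lam j) (lam (S j)) (dj j) (E j) n T g)
        as [l [Hl1 [Hl2 Hl3]]]; try easy; try lia.
      + apply Hch; lia.
      + apply HT2; lia.
      + intros i Hi; apply HT1; lia.
      + intros i Hi. destruct (HT2 i Hi) as [H1 H2]. rewrite Hy; lra.
      + intros s Hs Hf. apply (dist_difference_extremal Y0 Y1 Y2 s m p lam kap j); auto.
      + exists l; split; [easy|]; split; [|easy].
        intros x Hx. specialize (Hl2 x Hx). pose proof (HT2 (n - 1)%nat ltac:(lia)). lra. }
  assert (HG0 : G 0 = 0) by (unfold G; rewrite RInt_point; unfold zero; simpl; ring).
  rewrite HG0, psum_scal, psum_scal, Hn3 in Hsum. unfold G in Hsum.
  change (psum m (fun j => acos (dot (cone_pt (be j)) (cone_pt (be (S j)))))) with (psum m dj) in Hb3.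
  change (psum m (fun j => dj j)) with (psum m dj) in Hsum.
  assert (Hfin : (INR n - 3) * (L_Omega - 2 * L_Omega / (INR n - 3)) < (INR n - 3) * psum m dj).
  { apply Rmult_lt_compat_l; [lra|easy]. }
  replace ((INR n - 3) * (L_Omega - 2 * L_Omega / (INR n - 3))) with ((INR n - 5) * L_Omega)
    in Hfin by (field; lra).
  lra.
Qed.
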